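(* Let $G$ be a locally compact abelian group with Pontryagin dual $\hat G$ and trivial character $1_G\in\hat G$, and let $\varphi$ be a nonconstant, normalized ($\varphi(e)=1$) continuous positive definite function on $G$. Let $\pi_\varphi$ be the GNS representation of $G$ associated to $\varphi$, let $\mu_\varphi$ be the probability measure on $\hat G$ given by Bochner's theorem, i.e. $\varphi(x)=\int_{\hat G}\xi(x)\,d\mu_\varphi(\xi)$ for $x\in G$, and let $\mu_\varphi^\perp$ be the probability measure on $\hat G$ defined by $\mu_\varphi=\mu_\varphi(\{1_G\})\,\delta_{1_G}+(1-\mu_\varphi(\{1_G\}))\,\mu_\varphi^\perp$. 1) Consider the following statements: (i) $H^1(G,\pi_\varphi)=0$; (ii) both of the following properties are satisfied: (a) $\mu_\varphi(\{1_G\})=0$ or $\mathrm{Hom}(G,\mathbb{C})=0$; (b) $1_G\notin \mathrm{supp}(\mu_\varphi^\perp)$. Then (ii) $\Rightarrow$ (i), and the converse (i) $\Rightarrow$ (ii) holds if $G$ is $\sigma$-compact. 2) The following are equivalent: (i) $\overline{H}^1(G,\pi_\varphi)=0$; (ii) $\mu_\varphi(\{1_G\})=0$ or $\mathrm{Hom}(G,\mathbb{C})=0$.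
   Context: For a unitary representation $\pi$ of a locally compact group $G$ on a Hilbert space $\mathcal{H}_\pi$: $Z^1(G,\pi)=\{b:G\to\mathcal{H}_\pi : b \text{ continuous},\ b(gh)=\pi(g)b(h)+b(g)\ \text{for all } g,h\in G\}$ is the space of 1-cocycles; $B^1(G,\pi)=\{b\in Z^1(G,\pi): \exists v\in\mathcal{H}_\pi \text{ such that } b(g)=\pi(g)v-v \text{ for every } g\in G\}$ is the space of 1-coboundaries; $H^1(G,\pi)=Z^1(G,\pi)/B^1(G,\pi)$ is the 1-cohomology. Endow $Z^1(G,\pi)$ with the topology of uniform convergence on compact subsets of $G$; the reduced 1-cohomology is $\overline{H}^1(G,\pi)=Z^1(G,\pi)/\overline{B^1(G,\pi)}$. The GNS representation $(\pi_\varphi,\mathcal{H}_\varphi,\xi_\varphi)$ is the cyclic unitary representation (unique up to unitary equivalence) with cyclic vector $\xi_\varphi$ satisfying $\langle\pi_\varphi(x)\xi_\varphi\,|\,\xi_\varphi\rangle=\varphi(x)$ for all $x\in G$. $\mathrm{Hom}(G,\mathbb{C})$ is the space of continuous group homomorphisms from $G$ to the additive group $\mathbb{C}$. The measure $\mu_\varphi$ is a regular Borel probability measure, $\delta_{1_G}$ is the Dirac mass at $1_G$, and since $\varphi$ is not the constant function $1$ one has $\mu_\varphi(\{1_G\})<1$, so $\mu_\varphi^\perp$ is well defined. $\mathrm{supp}(\mu)$ denotes the (closed) support of a measure $\mu$. *)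

(* Defs.v *)
From HB Require Import structures.
From mathcomp Require Import all_boot all_order all_algebra.
From mathcomp Require Import all_classical all_reals all_analysis.
From mathcomp Require Export complex.

Set Implicit Arguments.
Unset Strict Implicit.
Unset Printing Implicit Defensive.

Import Order.TTheory GRing.Theory Num.Theory.
Import numFieldNormedType.Exports.

Local Open Scope classical_set_scope.
Local Open Scope ring_scope.
Local Open Scope complex_scope.

Lemma closure_zmod_closed (V : topologicalZmodType) (A : set V) :
  A 0 -> (forall x y, A x -> A y -> A (x - y)) ->
  closure A 0 /\ forall x y, closure A x -> closure A y -> closure A (x - y).
Proof.
move=> A0 AB; split=> [|x y Ax Ay P Pxy]; first exact: subset_closure.
have [[U W] /= [Ux Wy] UWP] := @sub_continuous V (x, y) _ Pxy.
have [u [Au Uu]] := Ax _ Ux; have [w [Aw Ww]] := Ay _ Wy.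
by exists (u - w); split; [exact: AB|exact: (UWP (u, w))].
Qed.

(** The norm of the underlying complete normed space is the one induced by the
    inner product, which is linear in its first argument.  Norms of complex
    normed spaces take values in the nonnegative reals of [R[i]]. *)

HB.mixin Record CompleteNormedModule_isHilbert (R : realType) H
    & CompleteNormedModule R[i] H := {
  inner : H -> H -> R[i] ;
  inner_linearl : forall a u v w,
    inner (a *: u + v) w = a * inner u w + inner v w ;
  inner_conj : forall u v, inner v u = (inner u v)^* ;
  inner_norm : forall u, inner u u = `|u| ^+ 2
}.

#[short(type="hilbertType")]
HB.structure Definition Hilbert (R : realType) :=
  {H of CompleteNormedModule R[i] H & CompleteNormedModule_isHilbert R H}.

(** Abelian topological groups are written additively. *)

Record unitary_rep (R : realType) (G : topologicalZmodType)
    (H : hilbertType R) := UnitaryRep {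
  rep :> G -> {linear H -> H} ;
  rep_inner : forall g u v, inner (rep g u) (rep g v) = inner u v ;
  rep0 : forall v, rep 0 v = v ;
  repD : forall g h v, rep (g + h) v = rep g (rep h v) ;
  rep_continuous : forall v, continuous (fun g => rep g v)
}.

Section cohomology.
Context {R : realType} {G : topologicalZmodType} {H : hilbertType R}.
Variable pi : unitary_rep G H.

Definition is_cocycle : {pred (G -> H)} :=
  fun b => `[< continuous b /\ forall g h, b (g + h) = pi g (b h) + b g >].

Lemma is_cocycle_submod : submod_closed is_cocycle.
Proof.
split=> [|a b c]; rewrite !unfold_in.
  by apply/asboolP; split=> [x|g h]; [exact: cvg_cst|rewrite /= raddf0 addr0].
move=> /asboolP[bc bM] /asboolP[cc cM]; apply/asboolP; split=> [x|g h].
  apply: (@cvgD _ _ _ _ _ (a *: b) c); last exact: cc.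
  by apply: cvgZr; exact: bc.
by rewrite !fctE/= bM cM linearP scalerDr addrACA.
Qed.

HB.instance Definition _ :=
  GRing.isSubmodClosed.Build R[i] (G -> H) is_cocycle
    (GRing.submod_closed_semi is_cocycle_submod).


(** The space of 1-cocycles, with the topology of uniform convergence on
    compact subsets of [G]. *)
Record Z1 := Cocycle { cocycle_fun :> G -> H ; _ : cocycle_fun \in is_cocycle }.

HB.instance Definition _ := [isSub for cocycle_fun].
HB.instance Definition _ := [Choice of Z1 by <:].
HB.instance Definition _ := [SubChoice_isSubLmodule of Z1 by <:].
HB.instance Definition _ := Topological.copy Z1
  (initial_topology (cocycle_fun : Z1 -> {family compact, G -> H})).

Lemma Z1_cvgP (F : set_system Z1) (b : Z1) : Filter F ->
  F --> b <-> forall (K : set G) (e : R[i]), compact K -> 0 < e ->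
    F [set c : Z1 | forall x, K x -> `|b x - c x| < e].
Proof.
move=> FF; split=> [Fb K e cK e0|Fb].
  pose val : Z1 -> {family compact, G -> H} := cocycle_fun.
  have Fb' : val @ F --> val b.
    apply: cvg_trans; last apply: (@initial_continuous _ _ val b).
    exact: cvg_app.
  have h := @fam_nbhs G H compact K [set xy | ball xy.1 e xy.2] b.
  have /h/(_ cK)/Fb' : entourage [set xy : H * H | ball xy.1 e xy.2].
    by rewrite -entourage_ballE; exists e.
  apply: (@filterS _ F FF) => c /= + x Kx => /(_ _ Kx).
  by rewrite -ball_normE.
have Fb' :
    {family compact, (fun c : Z1 => (c : G -> H)) @ F --> (b : G -> H)}.
  have FF' : Filter ((fun c : Z1 => (c : G -> H)) @ F) by exact: fmap_filter.
  apply/(@fam_cvgP G H compact _ b FF') => K cK P /uniform_nbhs[E [entE EP]].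
  move: entE; rewrite -entourage_ballE => -[e /= e0 eE].
  have := Fb K e cK e0; apply: (@filterS _ F FF) => c bc; apply: EP => y Ky.
  by apply: eE; rewrite /= -ball_normE; exact: bc.
move=> P [Q [[W oW <-] Wb] WP].
apply: (@filterS _ F FF _ _ WP); apply: (Fb' W).
exact: open_nbhs_nbhs.
Qed.

Lemma Z1_sub_continuous : continuous (fun bc : Z1 * Z1 => bc.1 - bc.2).
Proof.
move=> [b c]; apply/Z1_cvgP => K e cK e0.
have e2 : 0 < e / 2 by rewrite divr_gt0.
have hb := (Z1_cvgP b (nbhs_filter b)).1 cvg_id K _ cK e2.
have hc := (Z1_cvgP c (nbhs_filter c)).1 cvg_id K _ cK e2.
exists ([set b' : Z1 | forall x, K x -> `|b x - b' x| < e / 2],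
        [set c' : Z1 | forall x, K x -> `|c x - c' x| < e / 2]); first by split.
move=> [b' c'] [/= bb cc] x Kx.
have -> : b x - c x - (b' x - c' x) = (b x - b' x) - (c x - c' x).
  by rewrite !opprD !opprK addrACA.
rewrite /= (le_lt_trans (ler_normB _ _))//.
by rewrite [e]splitr ltrD ?bb ?cc.
Qed.

HB.instance Definition _ :=
  PreTopologicalNmodule_isTopologicalZmodule.Build Z1 Z1_sub_continuous.

Definition B1 : set Z1 := [set b | exists v, forall g, b g = pi g v - v].

Lemma B1_0 : B1 0.
Proof. by exists 0 => g; rewrite raddf0 subr0. Qed.

Lemma B1_sub b c : B1 b -> B1 c -> B1 (b - c).
Proof.
move=> [v bE] [w cE]; exists (v - w) => g.
have -> : (b - c) g = b g - c g by [].
by rewrite bE cE (raddfB (pi g)) !opprD !opprK addrACA.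
Qed.

Definition in_B1 : {pred Z1} := fun b => `[< B1 b >].
Definition in_closure_B1 : {pred Z1} := fun b => `[< closure B1 b >].

Lemma in_B1_zmod_closed : zmod_closed in_B1.
Proof.
split=> [|b c]; rewrite !unfold_in; first by apply/asboolP; exact: B1_0.
by move=> /asboolP Bb /asboolP Bc; apply/asboolP; exact: B1_sub.
Qed.

Lemma in_closure_B1_zmod_closed : zmod_closed in_closure_B1.
Proof.
have [cl0 clB] := closure_zmod_closed B1_0 B1_sub.
split=> [|b c]; rewrite !unfold_in; first exact/asboolP.
by move=> /asboolP Bb /asboolP Bc; apply/asboolP; exact: clB.
Qed.

HB.instance Definition _ :=
  GRing.isZmodClosed.Build Z1 in_B1 in_B1_zmod_closed.
HB.instance Definition _ :=
  GRing.isZmodClosed.Build Z1 in_closure_B1 in_closure_B1_zmod_closed.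

(** Only the additive group structure of the quotients is recorded. *)
Definition H1 : zmodType := Quotient.quot in_B1.
Definition reduced_H1 : zmodType := Quotient.quot in_closure_B1.

End cohomology.

Section positive_definite.
Context {R : realType} {G : topologicalZmodType}.

Definition positive_definite (phi : G -> R[i]^o) :=
  forall (n : nat) (c : 'I_n -> R[i]) (x : 'I_n -> G),
    0 <= \sum_i \sum_j c i * (c j)^* * phi (x i - x j).

Definition cyclic_vector (H : hilbertType R) (pi : unitary_rep G H) (v : H) :=
  closure [set w | exists (n : nat) (c : 'I_n -> R[i]) (x : 'I_n -> G),
    w = \sum_i c i *: pi (x i) v] = setT.

Definition is_GNS (phi : G -> R[i]^o) (H : hilbertType R)
    (pi : unitary_rep G H) (v : H) :=
  cyclic_vector pi v /\ forall x, inner (pi x v) v = phi x.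

End positive_definite.

Definition additive_characters (R : realType) (G : topologicalZmodType) :
    set (G -> R[i]^o) :=
  [set f | continuous f /\ forall x y, f (x + y) = f x + f y].
Arguments additive_characters : clear implicits.

Section dual.
Variables (R : realType) (G : topologicalZmodType).

Definition is_character : {pred (G -> R[i]^o)} := fun xi =>
  `[< [/\ continuous xi, forall x y, xi (x + y) = xi x * xi y
        & forall x, `|xi x| = 1] >].

(** The Pontryagin dual, with the topology of uniform convergence on compact
    subsets of [G]. *)
Record dual := Character {
  character_fun :> G -> R[i]^o ;
  _ : character_fun \in is_character
}.

HB.instance Definition _ := [isSub for character_fun].
HB.instance Definition _ := [Choice of dual by <:].
HB.instance Definition _ := Topological.copy dual
  (initial_topology (character_fun : dual -> {family compact, G -> R[i]^o})).

Lemma trivial_is_character : (fun=> 1) \in is_character.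
Proof.
rewrite unfold_in; apply/asboolP; split=> [x|x y|x]; first exact: cvg_cst.
  by rewrite mulr1.
by rewrite normr1.
Qed.

Definition trivial_character : dual := Character trivial_is_character.

HB.instance Definition _ := isPointed.Build dual trivial_character.

End dual.

Notation borel T := (g_sigma_algebraType (@open T)).

Section borel_measures.
Context {R : realType} {T : ptopologicalType}.
Variable mu : {measure set (borel T) -> \bar R}.

Definition regular_measure := forall A : set (borel T), measurable A ->
  mu A = ereal_inf [set mu U | U in [set U : set T | open U /\ A `<=` U]] /\
  mu A = ereal_sup [set mu K | K in [set K : set T | compact K /\ K `<=` A]].

Definition supp : set T :=
  [set x | forall U : set T, open U -> U x -> (0 < mu U)%E].

Definition complex_integral (f : T -> R[i]) : R[i] :=
  (\int[mu]_t complex.Re (f t))%R +i* (\int[mu]_t complex.Im (f t))%R.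

End borel_measures.

Definition sigma_compact (T : topologicalType) :=
  exists K : nat -> set T, (forall n, compact (K n)) /\ \bigcup_n K n = setT.

(* Main.v *)
Require Import Defs.
From HB Require Import structures.
From mathcomp Require Import all_boot all_order all_algebra.
From mathcomp Require Import all_classical all_reals all_analysis.
From mathcomp Require Import complex.
From mathcomp Require Import ring lra.
Set Implicit Arguments.
Unset Strict Implicit.
Unset Printing Implicit Defensive.
Import Order.TTheory GRing.Theory Num.Theory.
Import numFieldNormedType.Exports.
Import ComplexField.Normc.
Local Open Scope classical_set_scope.
Local Open Scope ring_scope.

(** The spectral picture behind the theorem identifies the representation with
    multiplication by [xi(g)] on [L^2(mu)].  A cocycle is then
    [b(g) = (xi(g) - 1) F] plus, on the atom of [mu] at the trivial character, a
    continuous homomorphism to [C]; it is a coboundary when the homomorphism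
    vanishes and [F] is square integrable, which can only fail near the trivial
    character.  The proof uses neither the full [L^2] model nor Haar measure:
    trigonometric polynomials [q] acting on the cyclic vector [v] are enough,
    through [|q(pi) v|^2 = \int |q|^2 dmu] ([spectral_norm]).

    Averages [mean_op pi s] over a finite multiset [s] of group elements carry the
    argument.  On the spectral side they are multiplication by
    [mean s xi = (xi(x_1) + ... + xi(x_n)) / n], which is [1] at the trivial
    character.  Regularity of [mu] and compactness give averages that are small
    away from the trivial character, so averages of [v] converge to an invariant
    vector [v0] with [|v0|^2 = mu{1}] ([invariant_projection]), and averages tend to
    zero on the orthogonal complement of [v0] ([average_to_zero]).

    Reduced cohomology.  Commutativity of the group makes [b - mean_op pi s b] a
    coboundary for every cocycle [b] ([cocycle_sub_mean_op]).  If [b] is orthogonal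
    to [v0], a suitable [s] makes [mean_op pi s b] uniformly small on a given compact
    set, hence [b] is a limit of coboundaries.  The component of [b] along [v0] is a
    continuous homomorphism; conversely [f(g) v0], for such a homomorphism [f], is
    orthogonal to every coboundary.

    Ordinary cohomology needs control that is uniform over the characters outside a
    neighbourhood of the trivial one.  The integral of [xi] over a compact set against
    a smooth density would decay there, but Haar measure is replaced by a counting
    argument ([folding]): a large box in the subgroup generated by finitely many
    small elements is folded back into a fixed compact set modulo a maximal separated
    subset.  This yields [uniform_detection]: for compact [K] and [e > 0] there are one
    compact set [K'] and one [r < 1] such that, for each finite subset [Y] of [K], some
    multiset [s] in [K'] satisfies [|mean s xi|^2 <= r] for all characters [xi] with
    [|xi y - 1| > e] at a point [y] of [Y].

    If the trivial character is not in the support of the rest of [mu], this gives a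
    spectral gap on the complement of [v0] ([spectral_gap]): vectors that are almost
    invariant on a compact set are small.  Coboundaries approximating a cocycle then
    come from a Cauchy sequence of vectors, and the cocycle is a coboundary.  If the
    trivial character is in that support, high powers of the same averages applied to
    [v - v0] are almost invariant vectors orthogonal to [v0] ([almost_invariant]).
    Their coboundaries, rescaled to grow quickly and summed, converge uniformly on the
    compact sets of an exhaustion to an unbounded cocycle ([gliding_hump]), which is
    not a coboundary. *)

(** * Folding a box into a compact set *)

Section folding.
Context {C : numFieldType} {G : zmodType}.
Implicit Types (x y : G) (F T : seq G).

(** The box of all [n_1 y_1 + ... + n_k y_k] with [0 <= n_j <= N] is almost invariant
    under each [y_j]: telescoping in the j-th direction leaves only two faces.  The box
    is a sequence, so that coincidences between its points are counted with
    multiplicity and the size is exactly [(N + 1)^k]. *)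
Lemma folner_sequence (Y : seq G) (N : nat) : exists2 F : seq G, (0 < size F)%N &
  forall y, y \in Y -> forall (f : G -> C) (B : C), (forall x, `|f x| <= B) ->
  `|\sum_(x <- F) f (x + y) - \sum_(x <- F) f x| * N.+1%:R
    <= (2 * size F)%:R * B.
Proof.
elim: Y => [|y0 Y [F' F'0 IH]]; first by exists [:: 0].
exists [seq z + y0 *+ n | z <- F', n <- iota 0 N.+1].
  by rewrite size_allpairs size_iota muln_gt0 F'0.
move=> y; rewrite inE size_allpairs size_iota.
have sumE (f : G -> C) : \sum_(x <- [seq z + y0 *+ n | z <- F', n <- iota 0 N.+1]) f x
    = \sum_(z <- F') \sum_(0 <= n < N.+1) f (z + y0 *+ n).
  by rewrite big_allpairs_dep.
move=> /predU1P[->|yY] f B fB; rewrite !sumE.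
  have -> : (2 * (size F' * N.+1))%:R * B = ((2 * size F')%:R * B) * N.+1%:R :> C.
    by rewrite !natrM; ring.
  rewrite -sumrB ler_wpM2r ?ler0n//.
  rewrite (eq_bigr (fun z => f (z + y0 *+ N.+1) - f z)); last first.
    move=> z _; have := telescope_sumr (fun n => f (z + y0 *+ n)) (leq0n N.+1).
    rewrite mulr0n addr0 => <-; rewrite -sumrB.
    by apply: eq_bigr => n _; rewrite mulrSr addrA.
  apply: le_trans (ler_norm_sum _ _ _) _.
  apply: (@le_trans _ _ (\sum_(z <- F') 2 * B)).
    apply: ler_sum => z _; apply: le_trans (ler_normB _ _) _.
    by rewrite mulrDl mul1r lerD.
  rewrite big_const_seq count_predT iter_addr_0 le_eqVlt; apply/orP; left.
  by apply/eqP; rewrite -[LHS]mulr_natl natrM; ring.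
rewrite exchange_big/= [X in _ - X]exchange_big/= -sumrB.
apply: le_trans (ler_wpM2r _ (ler_norm_sum _ _ _)) _; first by rewrite ler0n.
have -> : (2 * (size F' * N.+1))%:R * B = ((2 * size F')%:R * B) * N.+1%:R :> C.
  by rewrite !natrM; ring.
rewrite big_distrl/=.
apply: (@le_trans _ _ (\sum_(0 <= n < N.+1) (2 * size F')%:R * B)).
  apply: ler_sum => n _.
  have := IH y yY (fun x => f (x + y0 *+ n)) B (fun x => fB _).
  by under eq_bigr do rewrite addrAC.
by rewrite big_const_nat iter_addr_0 subn0 mulr_natr.
Qed.

(** Greedy selection; [V] is symmetric, so that separation and covering are measured by
    the same set. *)
Lemma maximal_separated (V : set G) F : V 0 -> (forall x, V x -> V (- x)) ->
  exists T, [/\ uniq T,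
    forall t t', t \in T -> t' \in T -> V (t - t') -> t = t' &
    forall x, x \in F -> exists2 t, t \in T & V (t - x)].
Proof.
move=> V0 VN; elim: F => [|x F [T [uT sT cT]]]; first by exists [::]; split.
have [[t tT Vtx]|nT] := pselect (exists2 t, t \in T & V (t - x)).
  by exists T; split=> // z; rewrite inE => /predU1P[->|/cT//]; exists t.
exists (x :: T); split.
- rewrite /= uT andbT; apply/negP => xT; apply: nT.
  by exists x; rewrite ?subrr.
- move=> t t'; rewrite !inE => /predU1P[->|tT] /predU1P[->|t'T]//.
  + by move=> /VN; rewrite opprB => ?; case: nT; exists t'.
  + by move=> ?; case: nT; exists t.
  + exact: sT.
- move=> z; rewrite inE => /predU1P[->|/cT[t tT Vtz]].
    by exists x; rewrite ?mem_head ?subrr.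
  by exists t; rewrite ?inE ?tT ?orbT.
Qed.

(** Two points of a [V]-separated set in one translate of [V2] coincide, so a
    translate of [K] contains at most as many of them as it takes translates of [V2]
    to cover [K]. *)
Lemma separated_count (V V2 K : set G) (ks T : seq G) x :
  (forall z, K z -> exists2 k, k \in ks & V2 (z - k)) ->
  (forall z z', V2 z -> V2 z' -> V (z - z')) ->
  uniq T -> (forall t t', t \in T -> t' \in T -> V (t - t') -> t = t') ->
  (count (fun t => `[< K (t - x)%R >]) T <= size ks)%N.
Proof.
move=> Kks V2V uT sT; rewrite -size_filter.
set T' := [seq t <- T | _].
have : forall t, exists k, t \in T' -> k \in ks /\ V2 (t - x - k).
  move=> t; case: (boolP (t \in T')) => [|_]; last by exists 0.
  by rewrite mem_filter => /andP[/asboolP/Kks[k kk V2k] _]; exists k.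
move=> /choice[h hP].
rewrite -(size_map h); apply: uniq_leq_size; last first.
  by move=> _ /mapP[t tT ->]; have [] := hP t tT.
rewrite map_inj_in_uniq ?filter_uniq// => t t' tT t'T htt'.
have [_ vt] := hP t tT; have [_ vt'] := hP t' t'T.
apply: sT; [by move: tT; rewrite mem_filter => /andP[]|
  by move: t'T; rewrite mem_filter => /andP[]|].
have := V2V _ _ vt vt'; rewrite htt'; congr (V _).
by rewrite opprB addrA subrK opprB addrA subrK.
Qed.

(** The increments of a nondecreasing sequence bounded by [c] cannot all exceed
    [c / M] during [M] steps. *)
Lemma slow_step (a : nat -> nat) (M c : nat) : (0 < M)%N ->
  (forall i, (a i <= a i.+1)%N) -> (a M <= c)%N ->
  exists2 i, (i < M)%N & (M * (a i.+1 - a i) <= c)%N.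
Proof.
move=> M0 aS aM; apply: contrapT => nex.
have h i : (i < M)%N -> (c < M * (a i.+1 - a i))%N.
  by move=> iM; rewrite ltnNge; apply/negP => ?; apply: nex; exists i.
have : (\sum_(0 <= i < M) c.+1 <= \sum_(0 <= i < M) M * (a i.+1 - a i))%N.
  rewrite big_nat_cond [X in (_ <= X)%N]big_nat_cond leq_sum// => i.
  by rewrite andbT => /andP[_ iM]; exact: h.
rewrite sum_nat_const_nat subn0 -big_distrr/= telescope_sumn_in// leq_pmul2l//.
by move=> /leq_trans/(_ (leq_subr _ _)); rewrite ltnNge aM.
Qed.

(** The final inequality of [folding], a combination of the hypotheses with nonnegative
    coefficients in the partially ordered field [C]. *)
Lemma folding_bookkeeping (E E1 E2 A c N' N sy f k : C) : 0 < c -> 0 <= k ->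
  E <= 2 * N' - N - sy -> A <= E + E1 -> N - sy <= E2 ->
  E1 * (8 * c * k) <= 2 * f * c -> E2 * (8 * c * k) <= 2 * f * c ->
  4 * c * k * (N' - N) <= c * f -> A * k <= f.
Proof.
move=> c0 k0 hE hA hN h1 h2 hs.
have c8 : 0 < 8 * c by rewrite mulr_gt0.
rewrite -(ler_pM2r c8).
have L0 : 0 <= 8 * c * k by rewrite mulr_ge0// ltW.
rewrite -subr_ge0 in hE; rewrite -subr_ge0 in hA; rewrite -subr_ge0 in hN.
have bD := mulr_ge0 L0 (addr_ge0 (addr_ge0 hE hA) hN).
rewrite -subr_ge0 in h1; rewrite -subr_ge0 in h2; rewrite -subr_ge0 in hs.
rewrite -subr_ge0.
have := addr_ge0 (addr_ge0 (addr_ge0 h1 h2) bD) (mulr_ge0 (ler0n _ 4) hs).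
by congr (_ <= _); ring.
Qed.

(** A substitute for averaging a character against Haar measure on [K].  Take a box
    [F] almost invariant under [Y], a [V]-separated set [T] that meets [x + V] for each
    [x] in [F], and let [s] be the multiset of differences [t - x] that lie in [B i],
    for [t] in [T] and [x] in [F].  Each [x] contributes at least one and at most [size ks]
    differences, whatever the size of [F].  Translation by [y] changes [s] in two
    ways: at the boundary of the box, which is negligible, and where [B i] and its
    translate differ.  Both lie in [B i.+1] and count equally many differences, up to
    boundary terms, so this change is negligible when [B i.+1] counts few more than [B i],
    for an [i] provided by [slow_step].  As translating [s] by
    [y] multiplies the sum of [chi] over [s] by [chi y], that sum is small unless
    [chi y] is close to [1]. *)
Lemma folding (V V2 K W : set G) (B : nat -> set G) (ks Y : seq G) (k : nat) :
  let M := (4 * size ks * k.+1)%N in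
  V 0 -> (forall x, V x -> V (- x)) ->
  (forall z, K z -> exists2 k, k \in ks & V2 (z - k)) ->
  (forall z z', V2 z -> V2 z' -> V (z - z')) ->
  V `<=` B 0%N -> B M `<=` K ->
  (forall i z w, B i z -> W w -> B i.+1 (z + w)) ->
  W 0 -> (forall x, W x -> W (- x)) ->
  (forall y, y \in Y -> W y) ->
  exists2 s : seq G, (0 < size s)%N /\ forall z, z \in s -> K z &
   forall y, y \in Y -> forall chi : G -> C,
     (forall x y, chi (x + y) = chi x * chi y) -> (forall x, `|chi x| = 1) ->
     `|chi y * (\sum_(z <- s) chi z) - \sum_(z <- s) chi z| * k.+1%:R
        <= (size s)%:R.
Proof.
move=> M V0 VN Kks V2V VB BK BW W0 WN YW.
pose c := size ks.
have BS i : B i `<=` B i.+1 by move=> z /BW/(_ W0); rewrite addr0.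
have Bmon i j : (i <= j)%N -> B i `<=` B j.
  by elim: j => [|j IH]; [rewrite leqn0 => /eqP ->|
    rewrite leq_eqVlt => /predU1P[->//|/IH h z /h /BS]].
have c0 : (0 < c)%N.
  have /Kks[k' + _] : K 0 by apply/BK/(Bmon 0%N) => //; exact: VB.
  by rewrite /c; case: (ks).
have M0 : (0 < M)%N by rewrite !muln_gt0 c0.
(* The constants 4 and 8 make each of the two error terms at most half of the
   allowed [size s / k.+1]. *)
have [F F0 FF] := folner_sequence (map -%R Y) (8 * c * k.+1).-1.
have [T [uT sT cT]] := maximal_separated F V0 VN.
(* [n i x] counts the differences contributed by [x] at scale [i]. *)
pose n i x := count (fun t => `[< B i (t - x) >]) T.
have nS i x : (n i x <= n i.+1 x)%N.
  by apply: sub_count => t /asboolP/BS ?; apply/asboolP.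
have nM i x : (i <= M)%N -> (n i x <= c)%N.
  move=> iM; apply: leq_trans (@separated_count V V2 K ks T x Kks V2V uT sT).
  by apply: sub_count => t /asboolP/(Bmon _ _ iM)/BK ?; apply/asboolP.
pose N i := (\sum_(x <- F) n i x)%N.
have NF i : (size F <= N i)%N.
  rewrite -sum1_size /N big_seq [X in (_ <= X)%N]big_seq; apply: leq_sum => x xF.
  rewrite -has_count; apply/hasP; have [t tT Vt] := cT x xF.
  by exists t => //; apply/asboolP/(Bmon 0%N) => //; exact: VB.
have NM i : (i <= M)%N -> (N i <= c * size F)%N.
  move=> iM; rewrite -sum1_size big_distrr/= leq_sum// => x _.
  by rewrite muln1; exact: nM.
have [i iM slow] : exists2 i, (i < M)%N & (M * (N i.+1 - N i) <= c * size F)%N.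
  by apply: slow_step => // [i|]; [exact: leq_sum|exact: NM].
pose s := flatten [seq [seq t - x | t <- T & `[< B i (t - x) >]] | x <- F].
have sumE (f : G -> C) : \sum_(z <- s) f z
    = \sum_(x <- F) \sum_(t <- T | `[< B i (t - x) >]) f (t - x).
  rewrite big_flatten/= big_map; apply: eq_bigr => x _.
  by rewrite big_map big_filter.
have sizeE : size s = N i.
  rewrite size_flatten /shape -map_comp sumnE big_map; apply: eq_bigr => x _.
  by rewrite /= size_map size_filter.
exists s.
  split; first by rewrite sizeE (leq_trans F0).
  move=> z /flattenP[_ /mapP[x xF ->] /mapP[t]].
  by rewrite mem_filter => /andP[/asboolP Bt _] ->; apply/BK/(Bmon i) => //; exact: ltnW.
move=> y yY chi chiD chi1.
rewrite sumE sizeE.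
set S := \sum_(x <- F) _.
pose g x := \sum_(t <- T | `[< B i (t - x) >]) chi (t - x).
have gc x : `|g x| <= c%:R.
  apply: le_trans (ler_norm_sum _ _ _) _.
  rewrite (eq_bigr (fun=> 1)); last by move=> t _; rewrite chi1.
  rewrite big_const_seq iter_addr_0 ler_nat.
  exact/nM/ltnW.
have nc x : `|(n i x)%:R : C| <= c%:R by rewrite normr_nat ler_nat nM// ltnW.
have NyF : - y \in map -%R Y by rewrite map_f.
have /= bg := FF _ NyF g _ gc.
have /= bn := FF _ NyF (fun x => (n i x)%:R) _ nc.
rewrite prednK ?muln_gt0 ?c0// in bg bn.
pose b j x t : bool := `[< B j (t - x) >].
have gE x : g (x - y) = chi y * \sum_(t <- T) (b i (x - y) t)%:R * chi (t - x).
  rewrite /g big_mkcond big_distrr/=; apply: eq_bigr => t _; rewrite /b.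
  case: asboolP => _; rewrite ?mul0r ?mulr0// mul1r -chiD; congr chi.
  by rewrite opprB addrCA.
have SE : S = \sum_(x <- F) \sum_(t <- T) (b i x t)%:R * chi (t - x).
  apply: eq_bigr => x _; rewrite big_mkcond; apply: eq_bigr => t _; rewrite /b.
  by case: asboolP => _; rewrite ?mul0r ?mul1r.
have nE j x : (n j x)%:R = \sum_(t <- T) (b j x t)%:R :> C.
  by rewrite /n -sum1_count natr_sum big_mkcond; apply: eq_bigr => t _; rewrite /b;
    case: asboolP.
(* Both indicators are at most the indicator of [B i.+1], hence their distance is at
   most twice the latter minus their sum. *)
have D1 : `|\sum_(x <- F) g (x - y) - chi y * S|
    <= 2 * (N i.+1)%:R - (N i)%:R - \sum_(x <- F) (n i (x - y))%:R.
  under eq_bigr do rewrite gE.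
  rewrite -big_distrr/= -mulrBr normrM chi1 mul1r SE -sumrB.
  apply: le_trans (ler_norm_sum _ _ _) _.
  rewrite !natr_sum mulr_sumr -!sumrB; apply: ler_sum => x _.
  rewrite !nE mulr_sumr -!sumrB; apply: le_trans (ler_norm_sum _ _ _) _.
  apply: ler_sum => t _; rewrite -mulrBl normrM chi1 mulr1.
  have bS : b i x t -> b i.+1 x t by move=> /asboolP/BS ?; exact/asboolP.
  have bS' : b i (x - y) t -> b i.+1 x t.
    move=> /asboolP/BW/(_ (WN _ (YW _ yY))); rewrite opprB addrCA addrC addrK => ?.
    exact/asboolP.
  case: (b i (x - y) t) bS'; case: (b i x t) bS; case: (b i.+1 x t) => h1 h2;
    do ?[by have := h1 isT|by have := h2 isT];
    rewrite ?subrr ?subr0 ?sub0r ?normrN ?normr0 ?normr1 ?mulr1 ?mulr0 ?subr0//.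
  - by rewrite -[2]/(1 + 1) addrK subrr.
  - by rewrite -[2]/(1 + 1) addrK.
  - by rewrite -[2]/(1 + 1) addrK.
set E1 := `|_ - _| in bg; set E2 := `|_ - _| in bn; set E := `|_ - _| in D1.
set A := `|_|; set sy := \sum_(x <- F) _ in D1.
have tri : A <= E + E1.
  have -> : A = `|(\sum_(x <- F) g (x - y) - S)
     - (\sum_(x <- F) g (x - y) - chi y * S)|.
    by rewrite /A; congr `|_|; ring.
  by rewrite [E + _]addrC; exact: ler_normB.
have e2 : (N i)%:R - sy <= E2.
  rewrite /E2 distrC natr_sum; apply: real_ler_norm.
  by apply: rpredB; apply: rpred_sum => x _; exact: realn.
have slow' : (M * (N i.+1 - N i))%:R <= (c * size F)%:R :> C by rewrite ler_nat.
rewrite natrM natrB ?leq_sum// in slow'.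
have NFi : (size F)%:R <= (N i)%:R :> C by rewrite ler_nat.
apply: le_trans NFi.
apply: (@folding_bookkeeping E E1 E2 _ c%:R (N i.+1)%:R (N i)%:R sy).
- by rewrite ltr0n.
- by rewrite ler0n.
- exact: D1.
- exact: tri.
- exact: e2.
- by move: bg; rewrite !natrM.
- by move: bn; rewrite !natrM.
- by move: slow'; rewrite /M !natrM.
Qed.

End folding.

(** * Uniform detection of characters away from the trivial one *)

Section topological_groups.
Context {G : topologicalZmodType}.

Lemma nbhs0_sub (V : set G) : nbhs 0 V ->
  exists W, [/\ nbhs 0 W, forall x, W x -> W (- x) &
    forall x y, W x -> W y -> V (x - y)].
Proof.
move=> V0; have : nbhs ((0 : G) - 0) V by rewrite subr0.
move=> /(@sub_continuous G (0, 0))[[A B] /= [A0 B0] AB].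
exists ((A `&` B) `&` [set x | (A `&` B) (- x)]); split.
- apply: filterI; first exact: filterI.
  have : nbhs (- (0 : G)) (A `&` B) by rewrite oppr0; exact: filterI.
  exact: opp_continuous.
- by move=> x [? ?]; split=> //=; rewrite opprK.
- by move=> x y [[Ax _] _] [[_ By] _]; exact: (AB (x, y)).
Qed.

Lemma nbhs0_sums (V : set G) (M : nat) : nbhs 0 V ->
  exists W, [/\ nbhs 0 W, forall x, W x -> W (- x) &
    forall l : seq G, (size l <= M)%N -> (forall x, x \in l -> W x) ->
      V (\sum_(x <- l) x)].
Proof.
elim: M V => [|M IH] V V0.
  have [W [W0 WN WV]] := nbhs0_sub V0; exists W; split=> // -[]// _ _.
  by rewrite big_nil; exact: nbhs_singleton.
have [V1 [V10 V1N V1V]] := nbhs0_sub V0; have [W [W0 WN WV1]] := IH _ V10.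
exists (W `&` V1); split; first exact: filterI.
- by move=> x [/WN ? /V1N].
- move=> [_ _|x l sl lW]; first by rewrite big_nil; exact: nbhs_singleton.
  rewrite big_cons -[X in _ + X]opprK; apply: V1V.
    by have [] := lW x (mem_head _ _).
  by apply/V1N/WV1 => // y yl; have [] := lW y _; rewrite // inE yl orbT.
Qed.

Lemma nbhs_translate (x : G) (V : set G) : nbhs 0 V -> nbhs x [set z | V (z - x)].
Proof.
move=> V0; have : nbhs (x - x) V by rewrite subrr.
suff : {for x, continuous (fun z => z - x)} by exact.
apply: (@continuous_comp _ _ _ (fun z : G => (z, x)) (fun z => z.1 - z.2)).
  by apply: cvg_pair => /=; [exact: cvg_id|exact: cvg_cst].
exact: sub_continuous.
Qed.

(** The cover is indexed by points of [K] so that the finite subcover remembers where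
    its members are centred. *)
Lemma compact_nbhs_cover (K : set G) (U : G -> set G) : compact K ->
  (forall x, K x -> nbhs x (U x)) ->
  exists2 ks : seq G, (forall k, k \in ks -> K k) &
    forall z, K z -> exists2 k, k \in ks & U k z.
Proof.
pose Gp : ptopologicalType := HB.pack (G : Type) G (isPointed.Build G 0).
have -> : @compact G = @cover_compact G := @compact_cover Gp.
move=> cK KU; have [|z Kz|D DK KD] := cK G K (fun k => (U k)^°).
- by move=> k _; exact: open_interior.
- by exists z => //; exact: KU.
exists (finmap.enum_fset D); first by move=> k /DK; rewrite inE.
by move=> z /KD[k kD /interior_subset Ukz]; exists k.
Qed.

Lemma compact_translates (K V : set G) : compact K -> nbhs 0 V ->
  exists2 ks : seq G, (forall k, k \in ks -> K k) &
    forall z, K z -> exists2 k, k \in ks & V (z - k).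
Proof.
move=> cK V0; apply: compact_nbhs_cover cK _ => x _; exact: nbhs_translate.
Qed.

Lemma compact_sum (A B : set G) : compact A -> compact B ->
  compact [set x | exists a b, [/\ A a, B b & x = a + b]].
Proof.
move=> cA cB.
have cAB : compact [set z.1 + z.2 | z in A `*` B].
  apply: (continuous_compact _ (compact_setX cA cB)).
  exact/continuous_subspaceT/add_continuous.
move: cAB.
congr compact; apply/seteqP; split=> [_ [[a b] [Aa Bb] <-]|_ [a [b [Aa Bb ->]]]].
  by exists a, b.
by exists (a, b).
Qed.

Lemma compact_nbhs0 : locally_compact [set: G] ->
  exists2 K : set G, compact K & nbhs 0 K.
Proof.
by move=> /(_ 0 I)[U]; rewrite withinET => U0 [cU _]; exists U.
Qed.

Lemma compact_seq (s : seq G) : compact [set x | x \in s].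
Proof. by apply: finite_compact; exact: finite_seq. Qed.

End topological_groups.

Section means.
Context {R : realType} {G : zmodType}.
Implicit Types (s t : seq G) (chi : G -> R[i]).

(** The Fourier transform of the uniform probability measure on the multiset [s]. *)
Definition mean s chi : R[i] := (\sum_(x <- s) chi x) / (size s)%:R.

(** Convolution of the uniform measures on [s] and [t]; repetitions are kept. *)
Definition addseq s t : seq G := [seq x + y | x <- s, y <- t].

Definition unimodular_hom chi :=
  (forall x y, chi (x + y) = chi x * chi y) /\ (forall x, normc (chi x) = 1).

Lemma mean_addseq s t chi : unimodular_hom chi ->
  mean (addseq s t) chi = mean s chi * mean t chi.
Proof.
move=> [chiD _]; rewrite /mean size_allpairs big_allpairs_dep natrM invfM mulrACA.
congr (_ * _); rewrite big_distrl/=; apply: eq_bigr => x _.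
by rewrite big_distrr/=; apply: eq_bigr => y _; rewrite chiD.
Qed.

Lemma normc_sum (I : Type) (r : seq I) (F : I -> R[i]) :
  normc (\sum_(i <- r) F i) <= \sum_(i <- r) normc (F i).
Proof.
elim/big_rec2 : _ => [|i y1 y2 _ h]; first by rewrite normc0.
by apply: le_trans (le_normcD _ _) _; rewrite lerD2l.
Qed.

Lemma normc_nat n : normc (n%:R : R[i]) = n%:R.
Proof.
by apply: complexI; rewrite /= -[LHS]/(`|n%:R : R[i]|) normr_nat rmorph_nat.
Qed.

Lemma normc_ge0 (z : R[i]) : 0 <= normc z.
Proof. by rewrite -ler0c -[X in _ <= X]/(`|z|) normr_ge0. Qed.

Lemma mean_le1 s chi : unimodular_hom chi -> normc (mean s chi) <= 1.
Proof.
move=> [_ chi1]; rewrite /mean normcM normcV normc_nat.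
have [->|s0] := eqVneq (size s) 0%N; first by rewrite invr0 mulr0.
rewrite ler_pdivrMr ?ltr0n ?lt0n// mul1r.
apply: le_trans (normc_sum _ _) _.
by rewrite (eq_bigr (fun=> 1))// big_const_seq count_predT iter_addr_0.
Qed.

Lemma normc_sq (z : R[i]) : normc z ^+ 2 = complex.Re z ^+ 2 + complex.Im z ^+ 2.
Proof. by case: z => a b /=; rewrite sqr_sqrtr// addr_ge0// sqr_ge0. Qed.

(** The parallelogram identity for [1] and [z]: the average of the trivial character and
    a character is strictly contracting where they differ. *)
Lemma normc_half (z : R[i]) : normc z = 1 ->
  normc ((1 + z) / 2) ^+ 2 = 1 - normc (z - 1) ^+ 2 / 4.
Proof.
move=> z1; rewrite normcM normcV (normc_nat 2) exprMn.
move: z1 => /(congr1 (fun x => x ^+ 2)); rewrite !normc_sq expr1n.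
case: z => a b /= h; apply: (@mulIf _ 4) => //.
rewrite mulrBl mul1r mulfVK//; have -> : 4 = 2 ^+ 2 :> R by ring.
rewrite -mulrA -exprMn mulVf// expr1n mulr1; lra.
Qed.

Lemma unimodular_hom0 chi : unimodular_hom chi -> chi 0 = 1.
Proof.
move=> [chiD chi1].
have /eqP : chi 0 * (chi 0 - 1) = 0 by rewrite mulrBr mulr1 -chiD addr0 subrr.
rewrite mulf_eq0 subr_eq0 => /orP[/eqP h|/eqP//].
by have := chi1 0; rewrite h normc0 => /eqP; rewrite eq_sym oner_eq0.
Qed.

Lemma mean_pair (g : G) chi : unimodular_hom chi ->
  mean [:: 0; g] chi = (1 + chi g) / 2.
Proof. by move=> /unimodular_hom0 chi0; rewrite /mean !big_cons big_nil addr0 chi0. Qed.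

(** [s] is the sum of the pairs [0, g] for [g] in [S]: one factor of the product
    [\prod (1 + chi g) / 2] is small and the other ones have modulus at most [1]. *)
Lemma finite_detection (S : seq G) (e : R) : 0 < e -> exists2 s : seq G, (0 < size s)%N &
  forall chi, unimodular_hom chi -> (exists2 g, g \in S & e < normc (chi g - 1)) ->
  normc (mean s chi) ^+ 2 <= 1 - e ^+ 2 / 4.
Proof.
move=> e0; elim: S => [|g S [s s0 IH]].
  by exists [:: 0] => // chi _ [].
exists (addseq [:: 0; g] s).
  by rewrite size_allpairs muln_gt0 s0.
move=> chi uchi [h hS eh]; rewrite mean_addseq// normcM exprMn.
have ev1 t : normc (mean t chi) ^+ 2 <= 1.
  by rewrite expr_le1 ?normc_ge0// mean_le1.
move: hS; rewrite inE => /predU1P[hg|hS].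
  apply: (@le_trans _ _ (normc (mean [:: 0; g] chi) ^+ 2)).
    by rewrite ler_piMr// sqr_ge0.
  have [_ chi1] := uchi; rewrite mean_pair// normc_half// lerB// ler_pM2r//.
  by rewrite ler_sqr ?nnegrE ?normc_ge0 -?hg ?ltW.
apply: (@le_trans _ _ (normc (mean s chi) ^+ 2)).
  by rewrite ler_piMl// sqr_ge0.
by apply: IH => //; exists h.
Qed.

End means.

Section detection.
Context {R : realType} {G : topologicalZmodType}.

(** [K] is fixed first, then [W] depends only on the precision [k]; the finite set [Y]
    enters last and affects only [s].  The sets [B i] of [folding] are [V] plus sums of
    at most [i] elements of [W], and [W] is chosen so small that all of them stay
    in [V + V]. *)
Lemma small_elements_detection : locally_compact [set: G] ->
  exists2 K : set G, compact K & forall k : nat, exists2 W : set G, nbhs 0 W &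
    forall Y : seq G, (forall y, y \in Y -> W y) ->
    exists s : seq G, [/\ (0 < size s)%N, forall z, z \in s -> K z &
      forall chi : G -> R[i], unimodular_hom chi -> forall y, y \in Y ->
        normc (mean s chi) * normc (chi y - 1) <= k.+1%:R^-1].
Proof.
move=> lcG; have [K cK K0] := compact_nbhs0 lcG.
exists K => // k.
have [V [V0 VN VK]] := nbhs0_sub K0.
have [V2 [V20 V2N V2V]] := nbhs0_sub V0.
have [ks _ Kks] := compact_translates cK V20.
pose M := (4 * size ks * k.+1)%N.
have [W [W0 WN WV]] := nbhs0_sums M V0.
exists W => // Y YW.
pose B i : set G := [set z | exists v l, [/\ V v, (size l <= i)%N,
  forall x, x \in l -> W x & z = v + \sum_(x <- l) x]].
have [] := @folding R[i] G V V2 K W B ks Y k (nbhs_singleton V0) VN Kks V2V.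
- by move=> x Vx; exists x, [::]; rewrite big_nil addr0.
- move=> _ [v [l [Vv sl lW ->]]]; rewrite -[X in _ + X]opprK; apply: VK => //.
  exact/VN/WV.
- move=> i _ w [v [l [Vv sl lW ->]]] Ww; exists v, (w :: l); split=> //.
    by move=> x; rewrite inE => /predU1P[->|/lW].
  by rewrite big_cons addrA addrAC.
- exact: nbhs_singleton.
- exact: WN.
- exact: YW.
move=> s [s0 sK] h; exists s; split=> // chi [chiD chi1] y yY.
have chi1' x : `|chi x| = 1 by rewrite -[LHS]/((normc (chi x))%:C)%C chi1.
have := h y yY chi chiD chi1'; rewrite -[X in _ - X]mul1r -mulrBl normrM.
have n0 : 0 < (size s)%:R :> R by rewrite ltr0n.
rewrite -[X in X * _ * _]/((normc (chi y - 1))%:C)%C.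
rewrite -[X in _ * X * _]/((normc (\sum_(z <- s) chi z))%:C)%C.
rewrite -!(rmorph_nat (real_complex R)) -!rmorphM lecR => hh.
rewrite /mean normcM normcV normc_nat mulrAC ler_pdivrMr// ler_pdivlMl ?ltr0n//.
by rewrite mulrC [X in X * _]mulrC.
Qed.

(** [K'] and [r] do not depend on the finite set [Y].  Cover [K] by finitely many
    translates [S + W] of a small neighbourhood [W].  If [chi] is far from [1] at
    [y = z + w], it is far from [1] at [z], which is detected by the fixed finite set
    [S], or at the small element [w], which is detected by folding; the convolution of
    both multisets detects both cases. *)
Lemma uniform_detection (K : set G) (e : R) : locally_compact [set: G] -> compact K ->
  0 < e ->
  exists2 K' : set G, compact K' & exists r : R, [/\ 0 < r, r < 1 &
    forall Y : seq G, (forall y, y \in Y -> K y) ->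
    exists s : seq G, [/\ (0 < size s)%N, forall z, z \in s -> K' z &
      forall chi : G -> R[i], unimodular_hom chi ->
        (exists2 y, y \in Y & e < normc (chi y - 1)) ->
        normc (mean s chi) ^+ 2 <= r]].
Proof.
move=> /small_elements_detection[K1 cK1 K1P] cK e0.
have e4 : 0 < e / 4 by rewrite divr_gt0.
have [k ke] : exists k : nat, k.+1%:R^-1 < e / 4.
  have := near_infty_natSinv_lt (PosNum e4) => -[k _ /(_ k (leqnn k))] ?.
  by exists k.
have [W W0 WP] := K1P k.
have [S _ KS] := compact_translates cK W0.
have e2 : 0 < e / 2 by rewrite divr_gt0.
have [sS sS0 sSP] := @finite_detection R G S _ e2.
exists [set x | exists a b, [/\ K1 a, [set x | x \in sS] b & x = a + b]].
  exact/compact_sum/compact_seq.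
exists (Num.max (1 - (e / 2) ^+ 2 / 4) (1 / 4)); split.
- by rewrite lt_max divr_gt0// orbT.
- by rewrite gt_max ltrBlDr ltrDl divr_gt0 ?exprn_gt0//=; lra.
move=> Y YK; pose Y' := [seq z | z <- [seq y - k | y <- Y, k <- S] & `[< W z >]].
have [|s [s0 sK1 sP]] := WP Y'.
  by move=> y; rewrite /Y' map_id mem_filter => /andP[/asboolP].
exists (addseq s sS); split.
- by rewrite size_allpairs muln_gt0 s0.
- move=> _ /allpairsP[[x y] /= [xs ys ->]]; exists x, y; split=> //.
  exact: sK1.
move=> chi uchi [y yY ey]; rewrite mean_addseq// normcM exprMn.
have ev1 t : normc (mean t chi) ^+ 2 <= 1.
  by rewrite expr_le1 ?normc_ge0// mean_le1.
have [z zS Wyz] := KS y (YK y yY).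
have [chiD chi1] := uchi.
have eyz : e < normc (chi (y - z) - 1) + normc (chi z - 1).
  apply: lt_le_trans ey _.
  have -> : chi y - 1 = chi z * (chi (y - z) - 1) + (chi z - 1).
    by rewrite mulrBr mulr1 -chiD [z + _]addrC subrK subrKA.
  by apply: le_trans (le_normcD _ _) _; rewrite normcM chi1 mul1r.
have [hz|hz] := ltP (e / 2) (normc (chi z - 1)).
  rewrite le_max; apply/orP; left.
  apply: (@le_trans _ _ (normc (mean sS chi) ^+ 2)).
    by rewrite ler_piMl// sqr_ge0.
  by apply: sSP => //; exists z.
rewrite le_max; apply/orP; right.
apply: (@le_trans _ _ (normc (mean s chi) ^+ 2)).
  by rewrite ler_piMr// sqr_ge0.
have yzY' : y - z \in Y'.
  rewrite /Y' map_id mem_filter; apply/andP; split; first exact/asboolP.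
  by apply/allpairsP; exists (y, z).
have := sP chi uchi _ yzY'.
set a := normc (mean s chi); set b := normc (chi (y - z) - 1) in eyz * => ab.
have a0 : 0 <= a by exact: normc_ge0.
have a2 : a <= 1 / 2.
  have : a * (e / 2) <= e / 4.
    by apply: le_trans (ltW (le_lt_trans ab ke)); rewrite ler_wpM2l//; lra.
  by rewrite -ler_pdivlMr//; congr (_ <= _); field; rewrite gt_eqF.
have -> : 1 / 4 = (1 / 2) ^+ 2 :> R by field.
by rewrite ler_sqr ?nnegrE.
Qed.

End detection.

(** * Hilbert spaces and averages of a representation *)

Section hilbert.
Local Open Scope complex_scope.
Context {R : realType} {H : hilbertType R}.
Implicit Types (u v w : H) (a : R[i]).

(** Norms are elements of [R[i]]; estimates are made on this real version. *)
Definition rnorm u : R := complex.Re `|u|.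

Lemma rnormE u : `|u| = (rnorm u)%:C.
Proof. by rewrite /rnorm RRe_real// ger0_real. Qed.

Lemma rnorm_ge0 u : 0 <= rnorm u.
Proof. by rewrite -ler0c -rnormE. Qed.

Lemma rnorm0 : rnorm 0 = 0.
Proof. by apply: complexI; rewrite -rnormE normr0. Qed.

Lemma rnorm_eq0 u : rnorm u = 0 -> u = 0.
Proof. by move=> u0; apply/eqP; rewrite -normr_eq0 rnormE u0. Qed.

Lemma rnormD u v : rnorm (u + v) <= rnorm u + rnorm v.
Proof. by rewrite -lecR rmorphD/= -!rnormE ler_normD. Qed.

Lemma rnormN u : rnorm (- u) = rnorm u.
Proof. by apply: complexI; rewrite -!rnormE normrN. Qed.

Lemma rnormB u v : rnorm (u - v) = rnorm (v - u).
Proof. by rewrite -rnormN opprB. Qed.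

Lemma rnorm_triangle w u v : rnorm (u - v) <= rnorm (u - w) + rnorm (w - v).
Proof. by rewrite -(subrKA w) rnormD. Qed.

Lemma rnormZ a u : rnorm (a *: u) = normc a * rnorm u.
Proof. by apply: complexI; rewrite -rnormE normrZ rnormE rmorphM. Qed.

Lemma rnorm_sum (I : Type) (r : seq I) (F : I -> H) :
  rnorm (\sum_(i <- r) F i) <= \sum_(i <- r) rnorm (F i).
Proof.
elim/big_rec2 : _ => [|i y1 y2 _ h]; first by rewrite rnorm0.
by apply: le_trans (rnormD _ _) _; rewrite lerD2l.
Qed.

Lemma inner_nr u : inner u u = (rnorm u ^+ 2)%:C.
Proof. by rewrite inner_norm rnormE rmorphXn. Qed.

Lemma innerZDl a u v w : inner (a *: u + v) w = a * inner u w + inner v w.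
Proof. exact: inner_linearl. Qed.

Lemma innerDl u v w : inner (u + v) w = inner u w + inner v w.
Proof. by have := innerZDl 1 u v w; rewrite scale1r mul1r. Qed.

Lemma inner0l w : inner 0 w = 0.
Proof. by apply: (addIr (inner 0 w)); rewrite -innerDl addr0 add0r. Qed.

Lemma innerZl a u w : inner (a *: u) w = a * inner u w.
Proof. by have := innerZDl a u 0 w; rewrite addr0 inner0l addr0. Qed.

Lemma innerNl u w : inner (- u) w = - inner u w.
Proof. by rewrite -scaleN1r innerZl mulN1r. Qed.

Lemma innerBl u v w : inner (u - v) w = inner u w - inner v w.
Proof. by rewrite innerDl innerNl. Qed.

Lemma inner_suml (I : Type) (r : seq I) (F : I -> H) w :
  inner (\sum_(i <- r) F i) w = \sum_(i <- r) inner (F i) w.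
Proof.
elim/big_rec2 : _ => [|i y1 y2 _ h]; first by rewrite inner0l.
by rewrite innerDl h.
Qed.

Lemma innerC u v : inner v u = (inner u v)^*.
Proof. exact: inner_conj. Qed.

Lemma innerDr u v w : inner w (u + v) = inner w u + inner w v.
Proof. by rewrite innerC innerDl rmorphD/= -!innerC. Qed.

Lemma innerZr a u w : inner w (a *: u) = a^* * inner w u.
Proof. by rewrite innerC innerZl rmorphM/= -innerC. Qed.

Lemma innerNr u w : inner w (- u) = - inner w u.
Proof. by rewrite innerC innerNl rmorphN/= -innerC. Qed.

Lemma innerBr u v w : inner w (u - v) = inner w u - inner w v.
Proof. by rewrite innerDr innerNr. Qed.

Lemma inner0r w : inner w 0 = 0.
Proof. by rewrite innerC inner0l conjc0. Qed.

Lemma inner_sumr (I : Type) (r : seq I) (F : I -> H) w :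
  inner w (\sum_(i <- r) F i) = \sum_(i <- r) inner w (F i).
Proof.
elim/big_rec2 : _ => [|i y1 y2 _ h]; first by rewrite inner0r.
by rewrite innerDr h.
Qed.

Lemma pythagoras u v : inner u v = 0 -> rnorm (u + v) ^+ 2 = rnorm u ^+ 2 + rnorm v ^+ 2.
Proof.
move=> uv; apply: complexI; rewrite rmorphD/= -!inner_nr innerDl !innerDr.
by rewrite uv (innerC u v) uv conjc0 addr0 add0r.
Qed.

(** Pythagoras for the decomposition of [u] along [v]. *)
Lemma cauchy_schwarz u v : normc (inner u v) <= rnorm u * rnorm v.
Proof.
have [v0|v0] := eqVneq (rnorm v) 0.
  by rewrite (rnorm_eq0 v0) inner0r normc0 rnorm0 mulr0.
pose c := inner u v / (rnorm v ^+ 2)%:C.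
have vv : (rnorm v ^+ 2)%:C != 0 by rewrite (inj_eq (@complexI R)) expf_neq0.
have ov : inner (u - c *: v) (c *: v) = 0.
  by rewrite innerZr innerBl innerZl inner_nr /c divfK// subrr mulr0.
have := pythagoras ov; rewrite subrK rnormZ => h.
have : normc c * rnorm v <= rnorm u.
  rewrite -(@ler_pXn2r _ 2) ?nnegrE ?mulr_ge0 ?rnorm_ge0 ?normc_ge0//.
  by rewrite h lerDr sqr_ge0.
have vp : 0 < rnorm v by rewrite lt_def v0 rnorm_ge0.
have -> : normc c = normc (inner u v) / rnorm v ^+ 2.
  rewrite /c normcM normcV; congr (_ / _); apply: complexI.
  by rewrite -[LHS]/(`|(rnorm v ^+ 2)%:C|) ger0_norm// ler0c sqr_ge0.
rewrite -(ler_pM2r vp); congr (_ <= _); field; exact: v0.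
Qed.

Lemma rnorm_cauchy_cvg (w : nat -> H) :
  (forall e, 0 < e -> exists N, forall n m, (N <= n)%N -> (N <= m)%N ->
    rnorm (w n - w m) <= e) ->
  exists l, forall e, 0 < e -> exists N, forall n, (N <= n)%N -> rnorm (w n - l) <= e.
Proof.
move=> wC.
have cw : cauchy (w @ \oo).
  apply/cauchy_ballP => -[e e'] /[dup] e0; rewrite ltcE/= => /andP[/eqP e'0 er0].
  have e20 : 0 < e / 2 by rewrite divr_gt0.
  have [N hN] := wC _ e20.
  exists (w @` [set n | (N <= n)%N], w @` [set n | (N <= n)%N]).
    by split; exists N => // n Nn; exists n.
  move=> [_ _] [[n Nn <-] [m Nm <-]]; rewrite -ball_normE/= rnormE e'0 ltcR.
  by apply: le_lt_trans (hN _ _ Nn Nm) _; lra.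
have cvw : cvg (w @ \oo) by exact: cauchy_cvg.
exists (lim (w @ \oo)) => e e0.
have e0' : 0 < e%:C by rewrite ltcR.
have [N _ hN] := (@cvgrPdist_lt _ _ _ _ _ w _).1 cvw _ e0'.
exists N => n Nn; have := hN n Nn; rewrite /= rnormE ltcR rnormB; exact: ltW.
Qed.

Lemma continuous_rnormP (T : topologicalType) (b : T -> H) : continuous b <->
  forall x e, 0 < e -> nbhs x [set y | rnorm (b x - b y) < e].
Proof.
split=> [bc x e e0|bc x].
  have e0' : 0 < e%:C by rewrite ltcR.
  have := (@cvgrPdist_lt _ _ _ _ (nbhs_filter x) b _).1 (bc x) _ e0'.
  by apply: filterS => y; rewrite /= rnormE ltcR.
apply: (@cvgrPdist_lt _ _ _ _ (nbhs_filter x) b _).2 => -[e e'] /[dup] e0.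
rewrite ltcE/= => /andP[/eqP e'0 er0].
by apply: filterS (bc x e er0) => y; rewrite /= rnormE e'0 ltcR.
Qed.

End hilbert.

Section representation.
Local Open Scope complex_scope.
Context {R : realType} {G : topologicalZmodType} {H : hilbertType R}.
Variable pi : unitary_rep G H.
Implicit Types (u v w : H) (s t : seq G).

Lemma rnorm_pi g w : rnorm (pi g w) = rnorm w.
Proof.
apply: (@pexpIrn _ 2) => //; rewrite ?nnegrE ?rnorm_ge0//.
by apply: complexI; rewrite -!inner_nr rep_inner.
Qed.

Lemma piC g h w : pi g (pi h w) = pi h (pi g w).
Proof. by rewrite -!repD addrC. Qed.

Lemma inner_piN g u w : inner (pi g u) w = inner u (pi (- g) w).
Proof. by rewrite -(rep_inner pi g u) -repD subrr rep0. Qed.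

Lemma piN g w : pi g (- w) = - pi g w. Proof. by rewrite raddfN. Qed.

Lemma piD g u w : pi g (u + w) = pi g u + pi g w. Proof. by rewrite raddfD. Qed.

Lemma piB g u w : pi g (u - w) = pi g u - pi g w. Proof. by rewrite raddfB. Qed.

Lemma piZ g a w : pi g (a *: w) = a *: pi g w. Proof. by rewrite linearZ. Qed.

Lemma pi_sum g (I : Type) (r : seq I) (F : I -> H) :
  pi g (\sum_(i <- r) F i) = \sum_(i <- r) pi g (F i).
Proof. by rewrite raddf_sum. Qed.

Definition mean_op s w : H := (size s)%:R^-1 *: \sum_(x <- s) pi x w.

Lemma mean_opB s u w : mean_op s (u - w) = mean_op s u - mean_op s w.
Proof.
rewrite /mean_op -scalerBr -sumrB; congr (_ *: _).
by apply: eq_bigr => x _; rewrite raddfB.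
Qed.

Lemma mean_op_addseq s t w : mean_op (addseq s t) w = mean_op s (mean_op t w).
Proof.
rewrite /mean_op size_allpairs big_allpairs_dep natrM invfM -scalerA; congr (_ *: _).
rewrite scaler_sumr; apply: eq_bigr => x _; rewrite linearZ/=.
by congr (_ *: _); rewrite raddf_sum; apply: eq_bigr => y _; rewrite repD.
Qed.

Lemma rnorm_mean_op s w : rnorm (mean_op s w) <= rnorm w.
Proof.
rewrite /mean_op rnormZ normcV normc_nat.
have [->|s0] := eqVneq (size s) 0%N; first by rewrite invr0 mul0r rnorm_ge0.
rewrite mulrC ler_pdivrMr ?ltr0n ?lt0n//.
apply: le_trans (rnorm_sum _ _) _.
rewrite (eq_bigr (fun=> rnorm w)); last by move=> x _; rewrite rnorm_pi.
by rewrite big_const_seq count_predT iter_addr_0 mulr_natr.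
Qed.

(** Since [g + x = x + g], [b g - pi x (b g) = b x - pi g (b x)]: for fixed [x] this is
    the coboundary of [- b x].  The average of these vectors over [s] is the
    required [u]. *)
Lemma cocycle_sub_mean_op (b : Z1 pi) s : (0 < size s)%N ->
  exists u, forall g, b g - mean_op s (b g) = pi g u - u.
Proof.
move=> s0; have /asboolP[_ bD] : (b : G -> H) \in is_cocycle pi by case: b.
pose n : R[i] := (size s)%:R; have n0 : n != 0 by rewrite pnatr_eq0 -lt0n.
exists (- (n^-1 *: \sum_(x <- s) b x)) => g.
have {1}-> : b g = n^-1 *: \sum_(x <- s) b g.
  rewrite big_const_seq count_predT iter_addr_0 -[b g *+ _]scaler_nat scalerA.
  by rewrite mulVf ?scale1r.
rewrite piN opprK piZ pi_sum [RHS]addrC /mean_op -/n -!scalerBr -!sumrB.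
congr (_ *: _); apply: eq_bigr => x _.
have := bD g x; rewrite [g + x]addrC bD => h.
apply/eqP; rewrite subr_eq addrAC eq_sym subr_eq addrC h addrC.
by rewrite eqxx.
Qed.

End representation.

(** * The dual group *)

Section dual_topology.
Context {R : realType} {G : topologicalZmodType}.
Local Notation D := (dual R G).
Local Notation one := (trivial_character R G).
Implicit Types (xi : D) (x g : G) (K : set G).

Lemma norm_normc (z : R[i]) : `|z| = ((normc z)%:C)%C. Proof. by []. Qed.

Lemma char_hom xi : unimodular_hom (xi : G -> R[i]).
Proof.
have /asboolP[_ xiM xi1] : (xi : G -> R[i]^o) \in @is_character R G by case: xi.
by split=> // x; apply: complexI; rewrite -norm_normc; exact: xi1.
Qed.

Lemma char0 xi : xi 0 = 1.
Proof. by apply: unimodular_hom0; exact: char_hom. Qed.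

Lemma dual_nbhs xi K (e : R) : compact K -> 0 < e ->
  nbhs xi [set eta : D | forall x, K x -> normc (xi x - eta x) < e].
Proof.
move=> cK e0.
pose val : D -> {family compact, G -> R[i]^o} := @character_fun R G.
have Fb' : val @ nbhs xi --> val xi by exact: (@initial_continuous _ _ val xi).
have h := @fam_nbhs G R[i]^o compact K [set xy | ball xy.1 (e%:C)%C xy.2] xi.
have e0' : 0 < (e%:C)%C by rewrite ltcR.
have /h/(_ cK)/Fb' : entourage [set xy : R[i]^o * R[i]^o | ball xy.1 (e%:C)%C xy.2].
  by rewrite -entourage_ballE; exists (e%:C)%C.
apply: (@filterS _ (nbhs xi)) => c /= + x Kx => /(_ _ Kx).
by rewrite -ball_normE/= norm_normc ltcR.
Qed.

Lemma dual_cvg (F : set_system D) xi : Filter F ->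
  (forall K (e : R), compact K -> 0 < e ->
    F [set eta : D | forall x, K x -> normc (xi x - eta x) < e]) -> F --> xi.
Proof.
move=> FF Fb.
have Fb' : {family compact, (fun c : D => (c : G -> R[i]^o)) @ F --> (xi : G -> R[i]^o)}.
  have FF' : Filter ((fun c : D => (c : G -> R[i]^o)) @ F) by exact: fmap_filter.
  apply/(@fam_cvgP G R[i]^o compact _ xi FF') => K cK P /uniform_nbhs[E [entE EP]].
  move: entE; rewrite -entourage_ballE => -[[e e'] /= /[dup] e0].
  rewrite ltcE/= => /andP[/eqP e'0 er0] eE.
  have := Fb K e cK er0; apply: (@filterS _ F FF) => c bc; apply: EP => y Ky.
  by apply: eE; rewrite /= -ball_normE/= norm_normc e'0 ltcR; exact: bc.
move=> P [Q [[W oW <-] Wb] WP].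
apply: (@filterS _ F FF _ _ WP); apply: (Fb' W).
exact: open_nbhs_nbhs.
Qed.

Lemma dual_eval_nbhs xi x (e : R) : 0 < e ->
  nbhs xi [set eta : D | normc (xi x - eta x) < e].
Proof.
move=> e0; have := dual_nbhs xi (@compact_set1 _ x) e0.
by apply: filterS => eta /(_ x erefl).
Qed.

(** Characters at distance more than [e] from the trivial one, uniformly on [K].  The
    strict inequality makes the set open for every [K], hence Borel. *)
Definition far_from_one K (e : R) : set D :=
  [set xi | exists2 x, K x & e < normc (xi x - 1)].

Lemma normcB (z w : R[i]) : normc (z - w) = normc (w - z).
Proof. by rewrite -normcN opprB. Qed.

Lemma far_from_one_open K e : open (far_from_one K e).
Proof.
rewrite openE => xi [x Kx ex]; have d0 : 0 < normc (xi x - 1) - e by rewrite subr_gt0.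
apply: filterS (dual_eval_nbhs xi x d0) => eta h; exists x => //.
have : normc (xi x - 1) <= normc (xi x - eta x) + normc (eta x - 1).
  by rewrite -(subrKA (eta x)) le_normcD.
by move=> /=; move: h => /=; lra.
Qed.

Lemma near_one K (e : R) : compact K -> 0 < e -> nbhs one (~` far_from_one K e).
Proof.
move=> cK e0; have := dual_nbhs one cK e0; apply: filterS => xi h [x Kx].
by rewrite ltNge => /negP; apply; rewrite normcB; exact/ltW/h.
Qed.

Lemma open_one_far_from_one (U : set D) : open U -> U one ->
  exists K e, [/\ compact K, 0 < e & ~` far_from_one K e `<=` U].
Proof.
move=> oU U1.
pose F := filter_from [set Ke : set G * R | compact Ke.1 /\ 0 < Ke.2]
  (fun Ke => ~` far_from_one Ke.1 Ke.2).
have FF : Filter F.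
  apply: filter_from_filter; first by exists (set0, 1); split => //; exact: compact0.
  move=> [K e] [K' e'] /= [cK e0] [cK' e'0]; exists (K `|` K', Num.min e e') => /=.
    by split; [exact: compactU|rewrite lt_min e0].
  move=> xi h; split=> -[x Kx ex]; apply: h; exists x.
  - by left.
  - by rewrite gt_min ex.
  - by right.
  - by rewrite gt_min ex orbT.
have : F --> one.
  apply: dual_cvg => K e cK e0; exists (K, e / 2); first by split=> //; rewrite divr_gt0.
  move=> xi h x Kx; rewrite normcB ltNge; apply/negP => h'; apply: h; exists x => //.
  by rewrite /=; apply: lt_le_trans h'; lra.
move=> /(_ U) [|[K e] [cK e0] KeU]; first exact: open_nbhs_nbhs.
by exists K, e.
Qed.

Lemma dual_neq xi (eta : D) : (forall x, xi x = eta x) -> xi = eta.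
Proof.
by move=> h; apply: val_inj => /=; exact/funext.
Qed.

Lemma dual_hausdorff : hausdorff_space D.
Proof.
move=> xi eta cl; apply: dual_neq => x; apply/eqP; apply: contrapT => /negP ne.
have d0 : 0 < normc (xi x - eta x) / 2.
  rewrite divr_gt0// lt_def normc_ge0 andbT; apply: contra ne => /eqP/eq0_normc.
  by move/eqP; rewrite subr_eq0.
have [z /= [h1 h2]] := cl _ _ (dual_eval_nbhs xi x d0) (dual_eval_nbhs eta x d0).
have : normc (xi x - eta x) <= normc (xi x - z x) + normc (z x - eta x).
  by rewrite -(subrKA (z x)) le_normcD.
by move: h1 h2; rewrite [normc (eta x - _)]normcB; lra.
Qed.

Lemma far_finite_detection K (e : R) (C : set D) : compact C -> C `<=` far_from_one K e ->
  exists2 Y : seq G, (forall y, y \in Y -> K y) &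
    forall xi, C xi -> exists2 y, y \in Y & e < normc (xi y - 1).
Proof.
rewrite compact_cover => cC CK.
have [|xi /CK[x Kx ex]|Y YK CY] := cC G K (fun x => far_from_one [set x] e).
- by move=> x _; exact: far_from_one_open.
- by exists x => //; exists x.
exists (finmap.enum_fset Y); first by move=> y /YK; rewrite inE.
by move=> xi /CY[y yY [_ -> ey]]; exists y.
Qed.

(** A compact set that avoids the trivial character avoids one of its basic
    neighbourhoods, because the dual is Hausdorff. *)
Lemma avoid_one_finite_detection (C : set D) : compact C -> ~ C one ->
  exists2 e : R, 0 < e & exists Y : seq G,
    forall xi, C xi -> exists2 y, y \in Y & e < normc (xi y - 1).
Proof.
move=> cC C1.
have : nbhs one (~` C).
  apply: open_nbhs_nbhs; split=> //; apply: closed_openC.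
  exact: compact_closed dual_hausdorff cC.
rewrite nbhsE => -[U [oU U1] UC].
have [K [e [cK e0 KU]]] := open_one_far_from_one oU U1.
have [|Y _ YP] := @far_finite_detection K e C cC.
  by move=> xi Cxi; apply: contrapT => /KU/UC; exact.
by exists e => //; exists Y.
Qed.

Lemma measurable_open_dual (U : set D) : open U -> measurable (U : set (borel D)).
Proof. by move=> oU; apply: sub_sigma_algebra. Qed.

Lemma measurable_compact_dual (C : set D) : compact C -> measurable (C : set (borel D)).
Proof.
move=> cC; rewrite -[C]setCK; apply: measurableC; apply: measurable_open_dual.
by apply: closed_openC; exact: compact_closed dual_hausdorff cC.
Qed.

Lemma measurable_one : measurable ([set one] : set (borel D)).
Proof. by apply: measurable_compact_dual; exact: compact_set1. Qed.

(** Bounded continuous functions are integrable for every Borel probability measure;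
    all integrands below are of this kind. *)
Definition bdcont (f : D -> R) := continuous f /\ exists B, forall xi, `|f xi| <= B.

Lemma bdcont_cst c : bdcont (fun=> c).
Proof. by split; [exact: cst_continuous|exists `|c|]. Qed.

Lemma bdcontD (f g : D -> R) : bdcont f -> bdcont g -> bdcont (fun xi => f xi + g xi).
Proof.
move=> [cf [B fB]] [cg [B' gB']]; split; first by move=> x;
  exact: continuousD (cf x) (cg x).
by exists (B + B') => xi; rewrite (le_trans (ler_normD _ _))// lerD.
Qed.

Lemma bdcontM (f g : D -> R) : bdcont f -> bdcont g -> bdcont (fun xi => f xi * g xi).
Proof.
move=> [cf [B fB]] [cg [B' gB']]; split; first by move=> x;
  exact: continuousM (cf x) (cg x).
by exists (B * B') => xi; rewrite normrM ler_pM.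
Qed.

Lemma bdcont_sum (I : Type) (r : seq I) (F : I -> D -> R) : (forall i, bdcont (F i)) ->
  bdcont (fun xi => \sum_(i <- r) F i xi).
Proof.
move=> h; elim: r => [|i r IH].
  by rewrite (_ : (fun _ => _) = fun=> 0); [exact: bdcont_cst|apply/funext => xi;
    rewrite big_nil].
rewrite (_ : (fun _ => _) = fun xi => F i xi + \sum_(i <- r) F i xi).
  exact: bdcontD.
by apply/funext => xi; rewrite big_cons.
Qed.

Lemma Re_le_normc (z : R[i]) : `|complex.Re z| <= normc z.
Proof.
rewrite -(@ler_pXn2r _ 2) ?nnegrE ?normc_ge0// normc_sq real_normK ?num_real//.
by rewrite lerDl sqr_ge0.
Qed.

Lemma Im_le_normc (z : R[i]) : `|complex.Im z| <= normc z.
Proof.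
rewrite -(@ler_pXn2r _ 2) ?nnegrE ?normc_ge0// normc_sq real_normK ?num_real//.
by rewrite lerDr sqr_ge0.
Qed.

Lemma bdcont_Re x : bdcont (fun xi => complex.Re (xi x)).
Proof.
split; last first.
  by exists 1 => xi; rewrite (le_trans (Re_le_normc _))//; have [_ ->] := char_hom xi.
move=> xi; apply: (@cvgrPdist_lt _ _ _ _ (nbhs_filter xi) _ _).2 => e e0.
apply: filterS (dual_eval_nbhs xi x e0) => eta /= h.
by apply: le_lt_trans h; rewrite -(raddfB (@complex.Re R : Rcomplex R -> R)) Re_le_normc.
Qed.

Lemma bdcont_Im x : bdcont (fun xi => complex.Im (xi x)).
Proof.
split; last first.
  by exists 1 => xi; rewrite (le_trans (Im_le_normc _))//; have [_ ->] := char_hom xi.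
move=> xi; apply: (@cvgrPdist_lt _ _ _ _ (nbhs_filter xi) _ _).2 => e e0.
apply: filterS (dual_eval_nbhs xi x e0) => eta /= h.
by apply: le_lt_trans h; rewrite -(raddfB (@complex.Im R : Rcomplex R -> R)) Im_le_normc.
Qed.

Variable mu : probability (borel D) R.

Lemma bdcont_integrable f (A : set (borel D)) : measurable A -> bdcont f ->
  mu.-integrable A (EFin \o f).
Proof.
move=> mA [cf [B fB]]; apply: measurable_bounded_integrable => //.
- by rewrite (le_lt_trans (probability_le1 mu mA))// ltry.
- apply: (@measurable_funS _ _ _ _ setT) => //.
  apply: (measurability _ (measurable_realfun.RGenOpens.measurableE R)) =>
    _ [_ [a [b ->] <-]].
  rewrite setTI; apply: measurable_open_dual.
  by apply: open_comp => // x _; exact: cf.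
- exists B; split; first exact: num_real.
  by move=> y By xi _; exact: le_trans (fB xi) (ltW By).
Qed.

Lemma Rintegral_sum (I : Type) (r : seq I) (F : I -> D -> R) (A : set (borel D)) :
  measurable A -> (forall i, bdcont (F i)) ->
  \int[mu]_(xi in A) (\sum_(i <- r) F i xi) = \sum_(i <- r) \int[mu]_(xi in A) F i xi.
Proof.
move=> mA h; elim: r => [|i r IH].
  rewrite big_nil; under eq_Rintegral do rewrite big_nil.
  by rewrite Rintegral_cst// mul0r.
rewrite big_cons -IH; under eq_Rintegral do rewrite big_cons.
by rewrite RintegralD//; apply: bdcont_integrable => //; exact: bdcont_sum.
Qed.

Lemma inner_regular (A : set (borel D)) (e : R) : regular_measure mu -> measurable A ->
  0 < e -> exists C : set D, [/\ compact C, C `<=` A & fine (mu (A `\` C)) <= e].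
Proof.
move=> /(_ _ _)/[swap] mA /(_ A mA)[_ supA] e0.
have fA : mu A \is a fin_num by exact: fin_num_measure.
have := @ub_ereal_sup_adherent _ [set mu K | K in [set K : set D | compact K /\ K `<=`
  A]] _ e0.
rewrite -supA => /(_ fA)[_ [C [cC CA] <-] h]; exists C; split=> //.
have mC := measurable_compact_dual cC.
rewrite measureD//; last by rewrite (le_lt_trans (probability_le1 mu mA))// ltry.
rewrite setIidr//.
have fC : mu C \is a fin_num by exact: fin_num_measure.
rewrite -lee_fin fineK; last by rewrite fin_numB fA.
by rewrite leeBlDr// -leeBlDl//; apply: ltW.
Qed.

End dual_topology.

(** * Spectral calculus of trigonometric polynomials *)

Section powers.
Local Open Scope complex_scope.
Context {R : realType} {G : zmodType}.

(** The convolution power of the uniform measure on [s]. *)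
Definition powseq (s : seq G) n := iter n (addseq s) [:: 0].

Lemma size_powseq s n : (0 < size s)%N -> (0 < size (powseq s n))%N.
Proof. by move=> s0; elim: n => //= n IH; rewrite size_allpairs muln_gt0 s0. Qed.

Lemma mean_powseq s n (chi : G -> R[i]) : unimodular_hom chi ->
  mean (powseq s n) chi = mean s chi ^+ n.
Proof.
move=> uchi; elim: n => [|n IH]; last by rewrite /= mean_addseq// IH exprS.
by rewrite /powseq /= /mean big_seq1 divr1 expr0 unimodular_hom0.
Qed.

End powers.

Section integrals.
Local Open Scope complex_scope.
Context {R : realType} {G : topologicalZmodType}.
Local Notation D := (dual R G).
Local Notation one := (trivial_character R G).
Variable mu : probability (borel D) R.
Implicit Types (f : D -> R) (A C : set (borel D)).

Lemma le_Rintegral_bdcont f g A : measurable A -> bdcont f -> bdcont g ->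
  (forall xi, A xi -> f xi <= g xi) ->
  \int[mu]_(xi in A) f xi <= \int[mu]_(xi in A) g xi.
Proof. by move=> mA bf bg fg; apply: le_Rintegral => //; exact: bdcont_integrable. Qed.

Lemma Rintegral_split f A C : measurable A -> measurable C -> C `<=` A -> bdcont f ->
  \int[mu]_(xi in A) f xi =
  \int[mu]_(xi in C) f xi + \int[mu]_(xi in A `\` C) f xi.
Proof.
move=> mA mC CA bf; rewrite -[in LHS](setDUK CA) Rintegral_setU//.
- exact: measurableD.
- by rewrite setDUK//; exact: bdcont_integrable.
- by rewrite disj_set2E setDIK.
Qed.

Lemma Rintegral_le_cst f A c : measurable A -> bdcont f -> (forall xi, A xi -> f xi <= c) ->
  \int[mu]_(xi in A) f xi <= c * fine (mu A).
Proof.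
move=> mA bf fc; rewrite -Rintegral_cst//.
by apply: le_Rintegral_bdcont => //; exact: bdcont_cst.
Qed.

Lemma Rintegral_ge_cst f A c : measurable A -> bdcont f -> (forall xi, A xi -> c <= f xi) ->
  c * fine (mu A) <= \int[mu]_(xi in A) f xi.
Proof.
move=> mA bf fc; rewrite -Rintegral_cst//.
by apply: le_Rintegral_bdcont => //; exact: bdcont_cst.
Qed.

Lemma fine_mu_le1 A : measurable A -> 0 <= fine (mu A) <= 1.
Proof.
move=> mA; rewrite fine_ge0//= -[1]/(fine 1%E) fine_le ?fin_num_measure//.
exact: probability_le1.
Qed.

(** The contribution of the atom at the trivial character, where every mean is [1]. *)
Lemma Rintegral_split_one f : bdcont f -> \int[mu]_xi f xi =
  f one * fine (mu [set one]) + \int[mu]_(xi in ~` [set one]) f xi.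
Proof.
move=> bf; rewrite (@Rintegral_split f setT [set one])//; last exact: measurable_one.
rewrite setTD; congr (_ + _); rewrite -Rintegral_cst//; last exact: measurable_one.
by apply: eq_Rintegral => xi; rewrite inE => ->.
Qed.

End integrals.

Section spectral.
Local Open Scope complex_scope.
Context {R : realType} {G : topologicalZmodType} {H : hilbertType R}.
Variable pi : unitary_rep G H.
Local Notation D := (dual R G).
Local Notation one := (trivial_character R G).
Variable mu : probability (borel D) R.
Implicit Types (u w : H) (q : seq (R[i] * G)) (f : D -> R[i]) (A : set (borel D)).

(** Trigonometric polynomials are lists of pairs of a coefficient and a group element;
    they act on vectors through the representation and on characters by evaluation. *)
Definition trig_op q u : H := \sum_(p <- q) p.1 *: pi p.2 u.
Definition trig q (xi : D) : R[i] := \sum_(p <- q) p.1 * xi p.2.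

(** [w] corresponds to [f] under the map [q(pi) u <-> q] from the span of the orbit of
    [u] to functions on the dual.  This is a relation because [q] need not be determined
    by the vector [q(pi) u]. *)
Definition has_symbol u w f := exists q, w = trig_op q u /\ f = trig q.

(** The spectral measure of [u] is the restriction of [mu] to [A].  It is used for
    [v] with [A] the whole dual, and for the part of [v] orthogonal to the invariant
    vectors, where [A] omits the trivial character. *)
Definition spectral u A := forall x, inner (pi x u) u =
  (\int[mu]_(xi in A) complex.Re (xi x)) +i* (\int[mu]_(xi in A) complex.Im (xi x)).

Lemma Re_mulc (a b : R[i]) : complex.Re (a * b)
   = complex.Re a * complex.Re b - complex.Im a * complex.Im b.
Proof. by case: a b => [? ?] [? ?]. Qed.

Lemma bdcont_ReM c x : bdcont (fun xi : D => complex.Re (c * xi x)).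
Proof.
rewrite (_ : (fun _ => _) = fun xi : D => complex.Re c * complex.Re (xi x) +
   (- complex.Im c) * complex.Im (xi x)); last by apply/funext => xi; rewrite Re_mulc mulNr.
by apply: bdcontD; apply: bdcontM;
  [exact: bdcont_cst|exact: bdcont_Re|exact: bdcont_cst|exact: bdcont_Im].
Qed.

Lemma spectral_Re u A c x : measurable A -> spectral u A ->
  complex.Re (c * inner (pi x u) u) = \int[mu]_(xi in A) complex.Re (c * xi x).
Proof.
move=> mA ->; rewrite Re_mulc.
have -> : \int[mu]_(xi in A) complex.Re (c * xi x) =
    \int[mu]_(xi in A) (complex.Re c * complex.Re (xi x) - complex.Im c * complex.Im (xi
      x)).
  by apply: eq_Rintegral => xi _; exact: Re_mulc.
rewrite RintegralB//; last 2 first.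
- by apply: bdcont_integrable => //; apply: bdcontM; [exact: bdcont_cst|exact: bdcont_Re].
- by apply: bdcont_integrable => //; apply: bdcontM; [exact: bdcont_cst|exact: bdcont_Im].
by rewrite !RintegralZl//; apply: bdcont_integrable => //;
  [exact: bdcont_Im|exact: bdcont_Re].
Qed.

(** A unimodular number has its conjugate as inverse. *)
Lemma char_sub (xi : D) x y : xi (x - y) = xi x * (xi y)^*.
Proof.
have [xiM xi1] := char_hom xi.
have y1 : xi y * (xi y)^* = 1.
  by rewrite -sqr_normc norm_normc xi1 expr1n.
rewrite -[LHS]mulr1 -y1 mulrA -xiM; congr (_ * _); congr (xi _).
by rewrite subrK.
Qed.

Lemma normc_trig_sq q (xi : D) : normc (trig q xi) ^+ 2 =
  \sum_(p <- q) \sum_(r <- q) complex.Re (p.1 * r.1^* * xi (p.2 - r.2)).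
Proof.
have -> : normc (trig q xi) ^+ 2 = complex.Re (trig q xi * (trig q xi)^*).
  rewrite normc_sq; case: (trig q xi) => a b /=; by rewrite mulrN opprK !expr2.
rewrite /trig rmorph_sum big_distrl/= raddf_sum; apply: eq_bigr => p _.
rewrite big_distrr/= raddf_sum; apply: eq_bigr => r _.
by rewrite rmorphM char_sub mulrACA.
Qed.

Lemma bdcont_trig q : bdcont (fun xi => normc (trig q xi) ^+ 2).
Proof.
rewrite (_ : (fun _ => _) = fun xi : D => \sum_(p <- q) \sum_(r <- q)
    complex.Re (p.1 * r.1^* * xi (p.2 - r.2))).
  by apply: bdcont_sum => p; apply: bdcont_sum => r; exact: bdcont_ReM.
by apply/funext => xi; rewrite normc_trig_sq.
Qed.

(** Expand the square on both sides; the coefficients of [p.1 * r.1^*] agree by the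
    definition of the spectral measure. *)
Lemma spectral_norm u A q : measurable A -> spectral u A ->
  rnorm (trig_op q u) ^+ 2 = \int[mu]_(xi in A) (normc (trig q xi) ^+ 2).
Proof.
move=> mA su; have -> : rnorm (trig_op q u) ^+ 2 = complex.Re (inner (trig_op q u)
  (trig_op q u)).
  by rewrite inner_nr.
under eq_Rintegral do rewrite normc_trig_sq.
rewrite Rintegral_sum//; last by move=> p; apply: bdcont_sum => r; exact: bdcont_ReM.
rewrite /trig_op inner_suml raddf_sum; apply: eq_bigr => p _.
rewrite inner_sumr raddf_sum Rintegral_sum//; last by move=> r; exact: bdcont_ReM.
apply: eq_bigr => r _; rewrite -(spectral_Re _ _ mA su) innerZl innerZr mulrA.
by rewrite [p.2 - _]addrC repD (inner_piN pi (- r.2)) opprK.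
Qed.

Lemma symbol_norm u A w f : measurable A -> spectral u A -> has_symbol u w f ->
  rnorm w ^+ 2 = \int[mu]_(xi in A) (normc (f xi) ^+ 2).
Proof. by move=> mA su [q [-> ->]]; exact: spectral_norm. Qed.

Lemma symbol_bdcont u w f : has_symbol u w f -> bdcont (fun xi => normc (f xi) ^+ 2).
Proof. by move=> [q [_ ->]]; exact: bdcont_trig. Qed.

Lemma symbol_trig u q : has_symbol u (trig_op q u) (trig q).
Proof. by exists q. Qed.

Lemma symbol_id u : has_symbol u u (fun=> 1).
Proof.
exists [:: (1, 0)]; split; first by rewrite /trig_op big_seq1 scale1r rep0.
by apply/funext => xi; rewrite /trig big_seq1 mul1r char0.
Qed.

Lemma symbol_add u w f w' f' : has_symbol u w f -> has_symbol u w' f' ->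
  has_symbol u (w + w') (fun xi => f xi + f' xi).
Proof.
move=> [q [-> ->]] [q' [-> ->]]; exists (q ++ q'); rewrite /trig_op big_cat; split=> //.
by apply/funext => xi; rewrite /trig big_cat.
Qed.

Lemma symbol_scale u w f c : has_symbol u w f -> has_symbol u (c *: w) (fun xi => c * f xi).
Proof.
move=> [q [-> ->]]; exists [seq (c * p.1, p.2) | p <- q]; split.
  by rewrite /trig_op big_map scaler_sumr; apply: eq_bigr => p _; rewrite scalerA.
apply/funext => xi; rewrite /trig big_map big_distrr/=.
by apply: eq_bigr => p _; rewrite mulrA.
Qed.

Lemma symbol_pi u w f g : has_symbol u w f -> has_symbol u (pi g w) (fun xi => xi g * f xi).
Proof.
move=> [q [-> ->]]; exists [seq (p.1, g + p.2) | p <- q]; split.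
  by rewrite /trig_op big_map pi_sum; apply: eq_bigr => p _; rewrite piZ repD.
apply/funext => xi; rewrite /trig big_map big_distrr/=.
by apply: eq_bigr => p _; have [-> _] := char_hom xi; rewrite mulrCA.
Qed.

Lemma symbol_ext u w f f' : has_symbol u w f -> (forall xi, f xi = f' xi) ->
  has_symbol u w f'.
Proof. by move=> h /funext <-. Qed.

Lemma symbol_sub u w f w' f' : has_symbol u w f -> has_symbol u w' f' ->
  has_symbol u (w - w') (fun xi => f xi - f' xi).
Proof.
move=> h /(symbol_scale (-1)) /(symbol_add h); rewrite scaleN1r => /symbol_ext; apply=> xi.
by rewrite mulN1r.
Qed.

Lemma symbol_coboundary u w f g : has_symbol u w f ->
  has_symbol u (pi g w - w) (fun xi => (xi g - 1) * f xi).
Proof.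
move=> h; apply: (symbol_ext (symbol_sub (symbol_pi g h) h)) => xi.
by rewrite mulrBl mul1r.
Qed.

Lemma symbol_mean_op u w f s : has_symbol u w f ->
  has_symbol u (mean_op pi s w) (fun xi => mean s xi * f xi).
Proof.
move=> h; have {}h : has_symbol u (\sum_(x <- s) pi x w) (fun xi =>
  (\sum_(x <- s) xi x) * f xi).
  elim: s => [|x s IH].
    exists [::]; rewrite /trig_op !big_nil; split => //; apply/funext => xi.
    by rewrite /trig !big_nil mul0r.
  rewrite big_cons; apply: (symbol_ext (symbol_add (symbol_pi x h) IH)) => xi.
  by rewrite big_cons mulrDl.
by apply: (symbol_ext (symbol_scale (size s)%:R^-1 h)) => xi;
  rewrite mulrA [X in X * _]mulrC.
Qed.

End spectral.

(** * The projection on invariant vectors *)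

Lemma natSinv_small {R : realType} (e : R) : 0 < e ->
  exists N, forall n, (N <= n)%N -> n.+1%:R^-1 <= e.
Proof.
move=> e0; have := near_infty_natSinv_lt (PosNum e0) => -[N _ NP].
by exists N => n /NP /= /ltW.
Qed.

Lemma geometric_small {R : realType} (r e : R) : 0 <= r -> r < 1 -> 0 < e ->
  exists n, r ^+ n <= e.
Proof.
move=> r0 r1 e0; have : `|r| < 1 by rewrite ger0_norm.
move=> /cvg_expr/cvgrPdist_lt/(_ e e0)[n _ /(_ n (leqnn n))] /=.
rewrite sub0r normrN ger0_norm ?exprn_ge0// => /ltW; by exists n.
Qed.

Lemma normcX {R : realType} (z : R[i]) n : normc (z ^+ n) = normc z ^+ n.
Proof. by elim: n => [|n IH]; rewrite ?expr0 ?normc1// !exprS normcM IH. Qed.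

Section small_averages.
Local Open Scope complex_scope.
Context {R : realType} {G : topologicalZmodType}.
Local Notation D := (dual R G).
Local Notation one := (trivial_character R G).
Variable mu : probability (borel D) R.
Hypothesis mu_regular : regular_measure mu.

Lemma symbol_mean (H : hilbertType R) (pi : unitary_rep G H) u s :
  has_symbol pi u (mean_op pi s u) (fun xi => mean s xi).
Proof. by apply: (symbol_ext (symbol_mean_op s (symbol_id pi u))) => xi; rewrite mulr1. Qed.

Lemma bdcont_mean (s : seq G) : bdcont (fun xi : D => normc (mean s xi) ^+ 2).
Proof.
have := @bdcont_trig R G [seq ((size s)%:R^-1, x) | x <- s].
congr (bdcont _); apply/funext => xi; congr (normc _ ^+ 2).
by rewrite /trig big_map -big_distrr/= mulrC.
Qed.

Lemma mean_sq_le1 (s : seq G) (xi : D) : normc (mean s xi) ^+ 2 <= 1.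
Proof. by rewrite expr_le1 ?normc_ge0// mean_le1//; exact: char_hom. Qed.

(** Regularity leaves a compact set [C] without the trivial character.  Some average is
    bounded by a constant less than [1] on [C], and its powers tend to zero
    there, while all averages have modulus at most [1] on the remaining set of small
    measure. *)
Lemma small_average (e : R) : 0 < e -> exists2 s : seq G, (0 < size s)%N &
  \int[mu]_(xi in ~` [set one]) (normc (mean s xi) ^+ 2) <= e.
Proof.
move=> e0; have e2 : 0 < e / 2 by rewrite divr_gt0.
have mA : measurable (~` [set one] : set (borel D)) by apply: measurableC;
  exact: measurable_one.
have [C [cC CA muC]] := inner_regular mu_regular mA e2.
have C1 : ~ C one by move=> /CA; exact.
have [d d0 [Y YP]] := avoid_one_finite_detection cC C1.
have [s s0 sP] := @finite_detection R G Y d d0.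
pose r : R := Num.max 0 (1 - d ^+ 2 / 4).
have r1 : r < 1.
  by rewrite gt_max ltr01/= ltrBlDr ltrDl divr_gt0// exprn_gt0.
have r0 : 0 <= r by rewrite le_max lexx.
have [n rn] := geometric_small r0 r1 e2.
have mC := measurable_compact_dual cC.
exists (powseq s n); first exact: size_powseq.
rewrite (@Rintegral_split _ _ _ _ _ C)//; last exact: bdcont_mean.
rewrite [e]splitr lerD//.
- apply: le_trans (@Rintegral_le_cst _ _ _ _ _ (r ^+ n) _ _ _) _ => //.
  + exact: bdcont_mean.
  + move=> xi Cxi; have uxi := char_hom xi.
    rewrite mean_powseq// normcX -exprM mulnC exprM.
    rewrite lerXn2r ?nnegrE ?exprn_ge0 ?normc_ge0//.
    by rewrite le_max sP ?orbT//; exact: YP.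
  + have /andP[m0 m1] := fine_mu_le1 mu mC.
    by apply: le_trans rn; rewrite ler_piMr// exprn_ge0.
- apply: le_trans (@Rintegral_le_cst _ _ _ _ _ 1 _ _ _) _ => //.
  + exact: measurableD.
  + exact: bdcont_mean.
  + by move=> xi _; exact: mean_sq_le1.
  + by rewrite mul1r.
Qed.

End small_averages.

Section invariant.
Local Open Scope complex_scope.
Context {R : realType} {G : topologicalZmodType} {H : hilbertType R}.
Variable pi : unitary_rep G H.
Local Notation D := (dual R G).
Local Notation one := (trivial_character R G).
Variable mu : probability (borel D) R.
Hypothesis mu_regular : regular_measure mu.
Variable v : H.
Hypothesis v_spec : spectral pi mu v setT.
Local Notation m := (fine (mu [set one])).

Lemma rnorm_cyclic_vector : rnorm v = 1.
Proof.
have := symbol_norm measurableT v_spec (symbol_id pi v).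
under eq_Rintegral do rewrite normc1 expr1n.
rewrite Rintegral_cst// mul1r => h.
have {h} /eqP := etrans h (congr1 fine (probability_setT mu)).
by rewrite sqrf_eq1 => /orP[/eqP//|/eqP h]; have := rnorm_ge0 v; rewrite h ler0N1.
Qed.

Lemma normcB_sq_le (a b : R[i]) : normc (a - b) ^+ 2 <= 2 * normc a ^+ 2 + 2 * normc b ^+ 2.
Proof.
rewrite !normc_sq; case: a b => [a a'] [b b'] /=; rewrite -subr_ge0.
have := addr_ge0 (sqr_ge0 (a + b)) (sqr_ge0 (a' + b')).
by congr (_ <= _); ring.
Qed.

(** Averages [w n] of [v] whose symbols tend to zero in [L^2] away from the trivial
    character.  All symbols are [1] at the trivial character, so the sequence is Cauchy;
    its limit [v0] is invariant since [(xi g - 1)] times the symbols tends to zero, and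
    its squared norm is what remains, the mass of the atom. *)
Lemma invariant_projection : exists v0 : H, [/\ forall g, pi g v0 = v0,
  rnorm v0 ^+ 2 = m & inner v v0 = (rnorm v0 ^+ 2)%:C].
Proof.
have mA : measurable (~` [set one] : set (borel D)) by apply: measurableC;
  exact: measurable_one.
have /choice[S SP] : forall n : nat, exists s : seq G, (0 < size s)%N /\
    \int[mu]_(xi in ~` [set one]) (normc (mean s xi) ^+ 2) <= n.+1%:R^-1.
  by move=> n; have [|s ? ?] := @small_average R G mu mu_regular n.+1%:R^-1;
    [rewrite invr_gt0|exists s].
have S0 n : (0 < size (S n))%N by have [] := SP n.
have Sle n : \int[mu]_(xi in ~` [set one]) (normc (mean (S n) xi) ^+ 2) <= n.+1%:R^-1.
  by have [] := SP n.
pose w n := mean_op pi (S n) v.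
have evone n : mean (S n) one = 1.
  by rewrite /mean /= big_const_seq count_predT iter_addr_0 divff// pnatr_eq0 -lt0n.
have wsp n := symbol_mean pi v (S n) : has_symbol pi v (w n) _.
have wdiff n k : rnorm (w n - w k) ^+ 2 <= 2 * n.+1%:R^-1 + 2 * k.+1%:R^-1.
  have dsp := symbol_sub (wsp n) (wsp k).
  rewrite (symbol_norm measurableT v_spec dsp) Rintegral_split_one;
    last exact: symbol_bdcont dsp.
  rewrite !evone subrr normc0 expr0n/= mul0r add0r.
  apply: le_trans (_ : \int[mu]_(xi in ~` [set one])
    (2 * normc (mean (S n) xi) ^+ 2 + 2 * normc (mean (S k) xi) ^+ 2) <= _).
    apply: le_Rintegral_bdcont => //; first exact: symbol_bdcont dsp.
    - by apply: bdcontD; apply: bdcontM;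
      [exact: bdcont_cst|exact: bdcont_mean|exact: bdcont_cst|exact: bdcont_mean].
    - by move=> xi _; exact: normcB_sq_le.
  have b2 j : bdcont (fun xi : D => 2 * normc (mean (S j) xi) ^+ 2).
    by apply: bdcontM; [exact: bdcont_cst|exact: bdcont_mean].
  rewrite RintegralD//; [|exact: bdcont_integrable|exact: bdcont_integrable].
  rewrite !RintegralZl//; try by apply: bdcont_integrable => //; exact: bdcont_mean.
  by rewrite lerD// ler_pM2l.
have [v0 v0P] : exists l, forall e : R, 0 < e -> exists N, forall n, (N <= n)%N ->
  rnorm (w n - l) <= e.
  apply: rnorm_cauchy_cvg => e e0.
  have [|N NP] := @natSinv_small R (e ^+ 2 / 4); first by rewrite divr_gt0// exprn_gt0.
  exists N => n k Nn Nk.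
  rewrite -(@ler_pXn2r _ 2) ?nnegrE ?rnorm_ge0 ?(ltW e0)//.
  by apply: le_trans (wdiff n k) _; have := NP n Nn; have := NP k Nk;
    move: (n.+1%:R^-1) (k.+1%:R^-1) => a b; lra.
have near_v0 (e : R) : 0 < e -> exists n, n.+1%:R^-1 <= e /\ rnorm (w n - v0) <= e.
  move=> e0; have [N NP] := natSinv_small e0; have [N' N'P] := v0P e e0.
  by exists (maxn N N'); split; [apply: NP; exact: leq_maxl|apply: N'P; exact: leq_maxr].
(* The displacement of [w n] has square at most [4 * (e^2 / 16)], and moving from [v0]
   to [w n] and back costs at most [e / 4] each way. *)
have v0inv g : pi g v0 = v0.
  apply/eqP; rewrite -subr_eq0; apply/eqP/rnorm_eq0/eqP.
  rewrite eq_le rnorm_ge0 andbT; apply/ler_addgt0Pr => e e0; rewrite add0r.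
  have [|n [n1 n2]] := near_v0 (Num.min (e / 4) (e ^+ 2 / 16)).
    by rewrite lt_min !divr_gt0// exprn_gt0.
  move: n1 n2; rewrite !le_min => /andP[_ n1] /andP[n2 _].
  have csp := symbol_coboundary g (wsp n).
  have : rnorm (pi g (w n) - w n) <= e / 2.
    rewrite -(@ler_pXn2r _ 2) ?nnegrE ?rnorm_ge0 ?divr_ge0 ?(ltW e0)//.
    rewrite (symbol_norm measurableT v_spec csp) Rintegral_split_one;
      last exact: symbol_bdcont csp.
    rewrite /= subrr mul0r normc0 expr0n/= mul0r add0r.
    apply: le_trans (_ : \int[mu]_(xi in ~` [set one]) (4 * normc (mean (S n) xi) ^+ 2)
      <= _).
      apply: le_Rintegral_bdcont => //; first exact: symbol_bdcont csp.
      - by apply: bdcontM; [exact: bdcont_cst|exact: bdcont_mean].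
      - move=> xi _; rewrite normcM exprMn ler_wpM2r ?sqr_ge0//.
        apply: le_trans (normcB_sq_le _ _) _; have [_ ->] := char_hom xi.
        by rewrite normc1 expr1n; lra.
    rewrite RintegralZl//; last by apply: bdcont_integrable => //; exact: bdcont_mean.
    by move: (Sle n) n1; move: (n.+1%:R^-1) => a; lra.
  have : rnorm (pi g (v0 - w n)) <= e / 4 by rewrite rnorm_pi rnormB.
  rewrite piB => h1 h2.
  have := rnorm_triangle (pi g (w n)) (pi g v0) v0.
  have := rnorm_triangle (w n) (pi g (w n)) v0.
  by lra.
have invN g : inner (pi g v) v0 = inner v v0 by rewrite inner_piN v0inv.
have winv n : inner (w n) v0 = inner v v0.
  rewrite /w /mean_op innerZl inner_suml (eq_bigr (fun=> inner v v0));
    last by move=> x _; exact: invN.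
  by rewrite big_const_seq count_predT iter_addr_0 -[inner v v0 *+ _]mulr_natl mulrA
    mulVf ?mul1r// pnatr_eq0 -lt0n.
exists v0; split=> //.
- apply/eqP; rewrite -subr_eq0 -normr_eq0 eq_le normr_ge0 andbT.
  apply/ler_addgt0Pr => e e0; rewrite add0r.
  have [|n [n1 n2]] := near_v0 (Num.min (e / 4) 1).
    by rewrite lt_min divr_gt0/=.
  move: n1 n2; rewrite !le_min => /andP[n1 _] /andP[n2 n3].
  have : m <= rnorm (w n) ^+ 2 <= m + e / 4.
    rewrite (symbol_norm measurableT v_spec (wsp n)) Rintegral_split_one;
      last exact: bdcont_mean.
    rewrite evone normc1 expr1n mul1r lerDl lerD2l (le_trans (Sle n))// andbT.
    by apply: Rintegral_ge0 => xi _; exact: sqr_ge0.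
  have wn1 : rnorm (w n) <= 1 by rewrite -rnorm_cyclic_vector rnorm_mean_op.
  have := rnorm_triangle 0 (w n) v0; have := rnormD (w n - v0) v0;
    have := rnormD (v0 - w n) (w n).
  rewrite !subrK [rnorm (v0 - w n)]rnormB.
  set a := rnorm (w n) in wn1 *; set b := rnorm v0; set c := rnorm _ in n2 n3 *.
  have a0 : 0 <= a by exact: rnorm_ge0.
  have b0 : 0 <= b by exact: rnorm_ge0.
  move=> h1 h2 _ /andP[h3 h4]; rewrite ler_norml; apply/andP; split; nra.
- apply/eqP; rewrite -inner_nr -subr_eq0; apply/eqP/eq0_normc/eqP.
  rewrite eq_le normc_ge0 andbT; apply/ler_addgt0Pr => e e0; rewrite add0r.
  have [|n [n1 n2]] := near_v0 (e / (rnorm v0 + 1)).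
    by rewrite divr_gt0// ltr_wpDl ?rnorm_ge0.
  rewrite -(winv n) -innerBl; apply: le_trans (cauchy_schwarz _ _) _.
  apply: le_trans (_ : e / (rnorm v0 + 1) * (rnorm v0 + 1) <= _); last first.
    by rewrite divfK// gt_eqF// ltr_wpDl ?rnorm_ge0.
  by apply: ler_pM; rewrite ?rnorm_ge0// lerDl.
Qed.

End invariant.

(** * Vanishing of cohomology in terms of cocycles *)

Section cohomology_criteria.
Local Open Scope complex_scope.
Local Open Scope quotient_scope.

Lemma quot_eq0 (V : zmodType) (I : zmodClosed V) :
  (forall b : Quotient.quot I, b = 0) <-> (forall x : V, x \in I).
Proof.
split=> [h x|h].
  have /eqP := etrans (h (\pi_(Quotient.quot I) x)) (esym (h (\pi_(Quotient.quot I) 0))).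
  by rewrite -Quotient.idealrBE subr0.
elim/quotW=> x; have /eqP := h x; rewrite -[x in x \in _]subr0 => /eqP.
by rewrite Quotient.idealrBE => /eqP ->; rewrite raddf0.
Qed.

Context {R : realType} {G : topologicalZmodType} {H : hilbertType R}.
Variable pi : unitary_rep G H.

Lemma H1_eq0 : (forall b : H1 pi, b = 0) <-> forall b : Z1 pi, B1 b.
Proof.
split=> [/quot_eq0 h b|h]; first exact/asboolP/h.
by apply/quot_eq0 => b; exact/asboolP/h.
Qed.

Lemma reduced_H1_eq0 :
  (forall b : reduced_H1 pi, b = 0) <-> forall b : Z1 pi, closure (@B1 R G H pi) b.
Proof.
split=> [/quot_eq0 h b|h]; first exact/asboolP/h.
by apply/quot_eq0 => b; exact/asboolP/h.
Qed.

Lemma cocycle_cont (b : Z1 pi) : continuous b.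
Proof. by have /asboolP[] : (b : G -> H) \in is_cocycle pi by case: b. Qed.

Lemma cocycleD (b : Z1 pi) g h : b (g + h) = pi g (b h) + b g.
Proof. by have /asboolP[_] : (b : G -> H) \in is_cocycle pi by case: b. Qed.

Lemma coboundary_is_cocycle (w : H) : (fun g => pi g w - w) \in is_cocycle pi.
Proof.
apply/asboolP; split.
  apply/continuous_rnormP => x e e0;
    have := (continuous_rnormP _).1 (@rep_continuous R G H pi w) x e e0.
  by apply: filterS => y /=; rewrite opprB addrA subrK.
by move=> g h; rewrite repD piB addrA subrK.
Qed.

Definition coboundary w : Z1 pi := Cocycle (coboundary_is_cocycle w).

Lemma closure_B1P (b : Z1 pi) : closure (@B1 R G H pi) b <->
  forall (K : set G) (e : R), compact K -> 0 < e ->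
    exists w, forall g, K g -> rnorm (b g - (pi g w - w)) < e.
Proof.
split=> [clb K e cK e0|h P bP].
  have e0' : 0 < e%:C by rewrite ltcR.
  have := (Z1_cvgP b (nbhs_filter b)).1 cvg_id K _ cK e0'.
  move=> /clb[c [[w cE]] cb]; exists w => g Kg; rewrite -cE -ltcR -rnormE.
  exact: cb.
pose F : set_system (Z1 pi) := filter_from [set Ke : set G * R | compact Ke.1 /\ 0 < Ke.2]
  (fun Ke => [set c : Z1 pi | forall x, Ke.1 x -> rnorm (b x - c x) < Ke.2]).
have FF : Filter F.
  apply: filter_from_filter; first by exists (set0, 1); split => //; exact: compact0.
  move=> [K e] [K' e'] /= [cK e0] [cK' e'0]; exists (K `|` K', Num.min e e') => /=.
    by split; [exact: compactU|rewrite lt_min e0].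
  move=> c cP; split=> x Kx.
    by have := cP x (or_introl Kx); rewrite lt_min => /andP[].
  by have := cP x (or_intror Kx); rewrite lt_min => /andP[].
have : F --> b.
  apply/Z1_cvgP => K [e e'] cK /[dup] e0; rewrite ltcE/= => /andP[/eqP e'0 er0].
  by exists (K, e) => // c cP x Kx; rewrite rnormE e'0 ltcR; exact: cP.
move=> /(_ P bP)[[K e] /= [cK e0] KeP].
have [w wP] := h K e cK e0.
exists (coboundary w); split; first by exists w.
exact: KeP.
Qed.

End cohomology_criteria.

(** * The complement of the invariant vectors *)

Section perp.
Local Open Scope complex_scope.
Context {R : realType} {G : topologicalZmodType} {H : hilbertType R}.
Variable pi : unitary_rep G H.
Local Notation D := (dual R G).
Local Notation one := (trivial_character R G).
Variable mu : probability (borel D) R.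
Hypothesis mu_regular : regular_measure mu.
Variable v : H.
Hypothesis v_spec : spectral pi mu v setT.
Hypothesis v_cyclic : cyclic_vector pi v.
Variable v0 : H.
Hypothesis v0inv : forall g, pi g v0 = v0.
Local Notation m := (fine (mu [set one])).
Hypothesis v0m : rnorm v0 ^+ 2 = m.
Hypothesis vv0 : inner v v0 = (rnorm v0 ^+ 2)%:C.

Local Notation v' := (v - v0).
Local Notation A1 := (~` [set one] : set (borel D)).

Lemma measurable_neq_one : measurable A1.
Proof. by apply: measurableC; exact: measurable_one. Qed.

Lemma inner_pi_v0 g w : inner (pi g w) v0 = inner w v0.
Proof. by rewrite inner_piN v0inv. Qed.

Lemma v'_orth : inner v' v0 = 0.
Proof. by rewrite innerBl vv0 inner_nr subrr. Qed.

Lemma trig_op_orth q : inner (trig_op pi q v') v0 = 0.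
Proof.
rewrite /trig_op inner_suml big1// => p _.
by rewrite innerZl inner_pi_v0 v'_orth mulr0.
Qed.

Lemma mean_op_orth s w : inner w v0 = 0 -> inner (mean_op pi s w) v0 = 0.
Proof.
move=> w0; rewrite /mean_op innerZl inner_suml big1 ?mulr0// => x _.
by rewrite inner_pi_v0.
Qed.

(** Subtracting [v0] from [v] removes the constant [mu{1}] from the matrix coefficient,
    that is, the atom from the spectral measure. *)
Lemma v'_spectral : spectral pi mu v' A1.
Proof.
move=> x; rewrite piB v0inv innerBr [X in _ - X]innerBl inner_pi_v0 vv0 inner_nr subrr
  subr0.
rewrite innerBl v_spec (innerC v v0) vv0 conjc_real v0m.
rewrite Rintegral_split_one; last exact: bdcont_Re.
rewrite Rintegral_split_one; last exact: bdcont_Im.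
by rewrite /= mul1r mul0r add0r; apply/eqP;
  rewrite eq_complex/= subr0 addrAC subrr add0r !eqxx.
Qed.

(** Approximate [w] by [q(pi) v].  Replacing [v] by [v - v0] removes a multiple of [v0]
    from the error, which is orthogonal to the rest of it. *)
Lemma perp_dense w (e : R) : inner w v0 = 0 -> 0 < e ->
  exists q, rnorm (w - trig_op pi q v') <= e.
Proof.
move=> w0 e0; have e0' : 0 < e%:C by rewrite ltcR.
have : closure [set w | exists (n : nat) (c : 'I_n -> R[i]) (x : 'I_n -> G),
    w = \sum_i c i *: pi (x i) v] w by rewrite v_cyclic.
move=> /(_ _ (nbhsx_ballx w e%:C e0'))[_ [[n [c [x ->]]]]].
rewrite -ball_normE/= rnormE ltcR => h.
exists [seq (c i, x i) | i <- index_enum 'I_n]; apply/ltW; apply: le_lt_trans h.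
set y := trig_op _ _ _; pose a := \sum_i c i.
have -> : \sum_i c i *: pi (x i) v = y + a *: v0.
  rewrite /y /trig_op big_map /a scaler_suml -big_split; apply: eq_bigr => i _ /=.
  by rewrite -scalerDr piB v0inv subrK.
have o : inner (w - y) (- (a *: v0)) = 0.
  by rewrite innerNr innerZr innerBl w0 trig_op_orth subrr mulr0 oppr0.
rewrite opprD addrA -(@ler_pXn2r _ 2) ?nnegrE ?rnorm_ge0// (pythagoras o).
by rewrite lerDl sqr_ge0.
Qed.

(** On [q(pi) (v - v0)] the averages of [small_average] tend to zero, because the symbol
    [q] is bounded; such vectors are dense and averages are contractions. *)
Lemma average_to_zero w (e : R) : inner w v0 = 0 -> 0 < e ->
  exists2 s : seq G, (0 < size s)%N & rnorm (mean_op pi s w) <= e.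
Proof.
move=> w0 e0; have e2 : 0 < e / 2 by rewrite divr_gt0.
have [q qP] := perp_dense w0 e2.
have [_ [B BP]] := bdcont_trig (G := G) q.
have B0 : 0 <= B by apply: le_trans (BP one).
have d0 : 0 < (e / 2) ^+ 2 / (B + 1) by rewrite divr_gt0 ?exprn_gt0// ltr_wpDl.
have [s s0 sP] := small_average mu_regular d0.
exists s => //.
have ssp := symbol_mean_op s (symbol_trig pi v' q).
have : rnorm (mean_op pi s (trig_op pi q v')) <= e / 2.
  rewrite -(@ler_pXn2r _ 2) ?nnegrE ?rnorm_ge0 ?(ltW e2)//.
  rewrite (symbol_norm measurable_neq_one v'_spectral ssp).
  have bB : bdcont (fun xi : D => B * normc (mean s xi) ^+ 2).
    by apply: bdcontM; [exact: bdcont_cst|exact: bdcont_mean].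
  apply: le_trans (_ : \int[mu]_(xi in A1) (B * normc (mean s xi) ^+ 2) <= _).
    apply: le_Rintegral_bdcont => //; [exact: measurable_neq_one|exact: symbol_bdcont ssp|].
    move=> xi _; rewrite normcM exprMn mulrC ler_wpM2r ?sqr_ge0//.
    by apply: le_trans (BP xi); rewrite ler_norm.
  rewrite RintegralZl//; [|exact: measurable_neq_one|apply: bdcont_integrable;
    [exact: measurable_neq_one|exact: bdcont_mean]].
  apply: le_trans (_ : B * ((e / 2) ^+ 2 / (B + 1)) <= _); first by rewrite ler_wpM2l.
  rewrite mulrCA ler_piMr ?sqr_ge0// ler_pdivrMr ?mul1r ?ltr_wpDl//.
  by rewrite lerDl.
have := rnorm_mean_op pi s (w - trig_op pi q v'); rewrite mean_opB.
have := rnormD (mean_op pi s w - mean_op pi s (trig_op pi q v')) (mean_op pi s (trig_op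
  pi q v')).
by rewrite subrK; lra.
Qed.

(** The averages commute and are contractions, so that further averaging does not undo
    what has been achieved for the other vectors. *)
Lemma average_seq_to_zero (ws : seq H) (e : R) : (forall w, w \in ws -> inner w v0 = 0) ->
  0 < e -> exists2 s : seq G, (0 < size s)%N &
    forall w, w \in ws -> rnorm (mean_op pi s w) <= e.
Proof.
move=> + e0; elim: ws => [_|w ws IH wsP]; first by exists [:: 0].
have [|s s0 sP] := IH; first by move=> w' w'P; apply: wsP; rewrite inE w'P orbT.
have [|t t0 tP] := @average_to_zero (mean_op pi s w) e _ e0.
  by apply: mean_op_orth; apply: wsP; rewrite mem_head.
exists (addseq t s); first by rewrite size_allpairs muln_gt0 t0.
move=> w'; rewrite inE mean_op_addseq => /predU1P[->//|/sP].
by apply: le_trans; exact: rnorm_mean_op.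
Qed.

(** By [cocycle_sub_mean_op] it suffices to find an average of [b] that is small on [K].
    As [b] is almost constant on each member of a finite cover of [K], only finitely many
    values of [b] have to be averaged to zero. *)
Lemma perp_cocycle_closure (b : Z1 pi) : (forall g, inner (b g) v0 = 0) ->
  closure (@B1 R G H pi) b.
Proof.
move=> b0; apply/closure_B1P => K e cK e0.
have e3 : 0 < e / 3 by rewrite divr_gt0.
have [|ks _ ksP] := @compact_nbhs_cover G K (fun x =>
  [set y | rnorm (b x - b y) < e / 3]) cK.
  by move=> x _; apply: ((continuous_rnormP b).1 (@cocycle_cont _ _ _ pi b)).
have [|s s0 sP] := @average_seq_to_zero [seq b k | k <- ks] (e / 3) _ e3.
  by move=> _ /mapP[k _ ->].
have [u uP] := cocycle_sub_mean_op b s0; exists u => g Kg.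
rewrite -uP opprB addrC subrK.
have [k kks bk] := ksP g Kg.
have := sP (b k) (map_f _ kks).
have := rnorm_mean_op pi s (b g - b k); rewrite mean_opB.
have := rnormD (mean_op pi s (b g) - mean_op pi s (b k)) (mean_op pi s (b k)).
by move: bk; rewrite subrK /= rnormB; lra.
Qed.

(** If all displacements of [w] were less than [|w| / 2], every average of the orbit
    would stay within [|w| / 2] of [w], although averages tend to zero. *)
Lemma coboundary_large w : inner w v0 = 0 -> w != 0 ->
  exists g, rnorm w / 2 <= rnorm (pi g w - w).
Proof.
move=> w0 wn0; apply: contrapT => /forallNP h.
have wp : 0 < rnorm w.
  by rewrite lt_def rnorm_ge0 andbT; apply: contra wn0 => /eqP/rnorm_eq0 ->.
have w4 : 0 < rnorm w / 4 by rewrite divr_gt0.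
have [s s0 sP] := average_to_zero w0 w4.
have : rnorm (mean_op pi s w - w) <= rnorm w / 2.
  have -> : mean_op pi s w - w = (size s)%:R^-1 *: \sum_(x <- s) (pi x w - w).
    rewrite sumrB scalerBr; congr (_ - _).
    rewrite big_const_seq count_predT iter_addr_0 -[w *+ _]scaler_nat scalerA mulVf
      ?scale1r//.
    by rewrite pnatr_eq0 -lt0n.
  rewrite rnormZ normcV normc_nat mulrC ler_pdivrMr ?ltr0n//.
  apply: le_trans (rnorm_sum _ _) _.
  apply: le_trans (_ : \sum_(x <- s) rnorm w / 2 <= _).
    by apply: ler_sum => x _; have /negP := h x; rewrite -ltNge => /ltW.
  by rewrite big_const_seq count_predT iter_addr_0 mulr_natr.
have := rnorm_triangle (mean_op pi s w) w 0; rewrite !subr0 rnormB.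
by lra.
Qed.

End perp.

(** * Spectral gap *)

Lemma normcB1_sq {R : realType} (z : R[i]) : normc z = 1 ->
  normc (z - 1) ^+ 2 = 2 - 2 * complex.Re z.
Proof.
move=> z1; have := congr1 (fun x => x ^+ 2) z1; rewrite !normc_sq expr1n.
by case: z {z1} => a b /= h; lra.
Qed.

(** The mean of [|chi x - 1|^2 = 2 - 2 Re (chi x)] over [s] is [2 - 2 Re (mean s chi)]. *)
Lemma displacement_lower {R : realType} {G : zmodType} (s : seq G) (chi : G -> R[i])
    (r : R) :
  unimodular_hom chi -> (0 < size s)%N -> normc (mean s chi) ^+ 2 <= r ->
  (1 - r) * (size s)%:R <= \sum_(x <- s) normc (chi x - 1) ^+ 2.
Proof.
move=> [_ chi1] s0 evr.
rewrite (eq_bigr (fun x => 2 - 2 * complex.Re (chi x))); last by move=> x _;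
  exact: normcB1_sq.
have n0 : 0 < (size s)%:R :> R by rewrite ltr0n.
have hRe : \sum_(x <- s) complex.Re (chi x) = complex.Re (mean s chi) * (size s)%:R.
  transitivity (complex.Re (mean s chi * (size s)%:R)); last first.
    by rewrite -(rmorph_nat (real_complex R)) Re_mulc/= mulr0 subr0.
  rewrite /mean divfK ?pnatr_eq0 -?lt0n//.
  by rewrite (raddf_sum (@complex.Re R : Rcomplex R -> R)).
have -> : \sum_(x <- s) (2 - 2 * complex.Re (chi x))
    = (2 - 2 * complex.Re (mean s chi)) * (size s)%:R.
  rewrite sumrB big_const_seq count_predT iter_addr_0 -mulr_sumr hRe.
  by rewrite -[X in X - _]mulr_natr; ring.
rewrite ler_wpM2r ?(ltW n0)//.
have := Re_le_normc (mean s chi); have := ler_norm (complex.Re (mean s chi)).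
move: evr; set a := normc _; set c := complex.Re _ => evr h1 h2.
have ca : c <= a := le_trans h1 h2; have sq := sqr_ge0 (1 - a). nra.
Qed.

Section spectral_gap.
Local Open Scope complex_scope.
Context {R : realType} {G : topologicalZmodType} {H : hilbertType R}.
Variable pi : unitary_rep G H.
Local Notation D := (dual R G).
Local Notation one := (trivial_character R G).
Variable mu : probability (borel D) R.
Hypothesis mu_regular : regular_measure mu.
Variable v : H.
Hypothesis v_spec : spectral pi mu v setT.
Hypothesis v_cyclic : cyclic_vector pi v.
Variable v0 : H.
Hypothesis v0inv : forall g, pi g v0 = v0.
Local Notation m := (fine (mu [set one])).
Hypothesis v0m : rnorm v0 ^+ 2 = m.
Hypothesis vv0 : inner v v0 = (rnorm v0 ^+ 2)%:C.
Hypothesis lcG : locally_compact [set: G].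

Local Notation v' := (v - v0).
Local Notation A1 := (~` [set one] : set (borel D)).

Lemma far_from_one_neq (K : set G) (e : R) : 0 < e -> far_from_one K e `<=` (A1 : set D).
Proof.
move=> e0 xi [x Kx ex] xi1; move: ex; rewrite xi1.
have -> : one x = 1 by [].
by rewrite subrr normc0 ltNge (ltW e0).
Qed.

(** Up to a set of small measure, the symbol [q] lives on a compact set [C] of characters
    far from the trivial one.  The multiset [s] that detects [C] lies in [K'], and the
    mean over [s] of [|(xi g - 1) q|^2] is at least [(1 - r) |q|^2] on [C], while the
    integral of each term is the square of a displacement.  The multiset depends
    on [C], but [K'] and [r] do not, so that the error set can be exhausted. *)
Lemma spectral_gap_trig K (e : R) : compact K -> 0 < e ->
  mu (A1 `\` far_from_one K e) = 0%E ->
  exists2 K' : set G, compact K' & exists k : R, [/\ 0 < k, k <= 1 &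
    forall q d, (forall g, K' g -> rnorm (pi g (trig_op pi q v') - trig_op pi q v') <= d) ->
      k * rnorm (trig_op pi q v') ^+ 2 <= d ^+ 2].
Proof.
move=> cK e0 mu0.
have [K' cK' [r [r0 r1 KP]]] := @uniform_detection R G K e lcG cK e0.
exists K' => //; exists (1 - r); split; [by rewrite subr_gt0|by rewrite gerBl ltW|].
move=> q d qd; set w := trig_op pi q v' in qd *.
have k0 : 0 < 1 - r by rewrite subr_gt0.
have sw := symbol_trig pi v' q; rewrite -/w in sw.
have vs := v'_spectral v_spec v0inv v0m vv0.
have mE : measurable (far_from_one K e : set (borel D)) by apply: measurable_open_dual;
  exact: far_from_one_open.
have bq := bdcont_trig (G := G) (R := R) q.
have [_ [B BP]] := bq.
have B0 : 0 <= B by apply: le_trans (BP one).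
have qB xi : normc (trig q xi) ^+ 2 <= B by apply: le_trans (BP xi); rewrite ler_norm.
apply/ler_addgt0Pr => t t0.
have tB : 0 < t / (B + 1) by rewrite divr_gt0// ltr_wpDl.
have [C [cC CE muC]] := inner_regular mu_regular mE tB.
have mC := measurable_compact_dual cC.
have [Y YK YC] := far_finite_detection cC CE.
have [s [s0 sK' sP]] := KP Y YK.
have n0 : 0 < (size s)%:R :> R by rewrite ltr0n.
have mAE : measurable (A1 `\` far_from_one K e) by apply: measurableD => //;
  exact: measurable_neq_one.
rewrite (symbol_norm (@measurable_neq_one R G) vs sw) (@Rintegral_split _ _ mu _ A1
  (far_from_one K e))//; [|exact: measurable_neq_one|exact: far_from_one_neq].
have z1 : \int[mu]_(xi in A1 `\` far_from_one K e) (normc (trig q xi) ^+ 2) <= 0.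
  apply: le_trans (@Rintegral_le_cst _ _ mu _ _ B _ _ _) _ => //.
  have muz : fine (mu (A1 `\` far_from_one K e)) = 0 by rewrite mu0.
  by rewrite [X in _ * X](_ : _ = 0) ?mulr0.
rewrite (@Rintegral_split _ _ mu _ (far_from_one K e) C)//.
have mEC : measurable ((far_from_one K e : set (borel D)) `\` C) by exact: measurableD.
have z2 : \int[mu]_(xi in (far_from_one K e : set (borel D)) `\` C) (normc (trig q xi) ^+
  2) <= t.
  apply: le_trans (@Rintegral_le_cst _ _ mu _ _ B _ _ _) _ => //.
  apply: le_trans (ler_wpM2l B0 muC) _.
  rewrite mulrCA ler_piMr ?(ltW t0)// ler_pdivrMr ?mul1r ?ltr_wpDl//.
  by rewrite lerDl.
have bg g : bdcont (fun xi : D => normc ((xi g - 1) * trig q xi) ^+ 2).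
  exact: symbol_bdcont (symbol_coboundary g sw).
have z3 : (1 - r) * \int[mu]_(xi in C) (normc (trig q xi) ^+ 2) <= d ^+ 2.
  rewrite -RintegralZl//; last exact: bdcont_integrable.
  rewrite -(ler_pM2r n0) mulrC -RintegralZl//; last first.
    by apply: bdcont_integrable => //; apply: bdcontM => //; exact: bdcont_cst.
  apply: le_trans (_ : \int[mu]_(xi in C)
     (\sum_(g <- s) normc ((xi g - 1) * trig q xi) ^+ 2) <= _).
    apply: le_Rintegral_bdcont => //.
    - by apply: bdcontM; [exact: bdcont_cst|apply: bdcontM => //; exact: bdcont_cst].
    - exact: bdcont_sum.
    - move=> xi Cxi; rewrite mulrA.
      rewrite (eq_bigr (fun g => normc (xi g - 1) ^+ 2 * normc (trig q xi) ^+ 2));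
        last first.
        by move=> g _; rewrite normcM exprMn.
      rewrite -big_distrl/= ler_wpM2r ?sqr_ge0// mulrC.
      have uxi := char_hom xi.
      by apply: displacement_lower => //; apply: sP => //; exact: YC.
  rewrite Rintegral_sum//.
  apply: le_trans (_ : \sum_(g <- s) d ^+ 2 <= _); last first.
    by rewrite big_const_seq count_predT iter_addr_0 mulr_natr.
  rewrite big_seq [leRHS]big_seq; apply: ler_sum => g gs.
  apply: le_trans (_ : rnorm (pi g w - w) ^+ 2 <= _); last first.
    have dg := qd g (sK' g gs).
    by rewrite ler_pXn2r ?nnegrE ?rnorm_ge0// (le_trans (rnorm_ge0 _) dg).
  rewrite (symbol_norm (@measurable_neq_one R G) vs (symbol_coboundary g sw)).
  rewrite [leRHS](@Rintegral_split _ _ mu _ A1 C)//; [|exact: measurable_neq_one|].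
    by rewrite lerDl; apply: Rintegral_ge0 => xi _; exact: sqr_ge0.
  by move=> xi /CE; exact: far_from_one_neq.
move: z1 z2 z3; set a := \int[mu]_(_ in C) _; set b := \int[mu]_(_ in _ `\` C) _.
set c := \int[mu]_(_ in _ `\` _) _ => z1 z2 z3.
by nra.
Qed.

(** [spectral_gap_trig] extended to all vectors orthogonal to [v0] by density. *)
Lemma spectral_gap K (e : R) : compact K -> 0 < e ->
  mu (A1 `\` far_from_one K e) = 0%E ->
  exists2 K' : set G, compact K' & exists2 c : R, 0 < c &
    forall w d, inner w v0 = 0 -> (forall g, K' g -> rnorm (pi g w - w) <= d) ->
      0 <= d -> rnorm w <= c * d.
Proof.
move=> cK e0 mu0; have [K' cK' [k [k0 k1 kP]]] := spectral_gap_trig cK e0 mu0.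
exists K' => //; exists k^-1; first by rewrite invr_gt0.
move=> w d w0 wd d0; apply/ler_addgt0Pr => t t0.
pose h := t * k / 4; have h0 : 0 < h by rewrite divr_gt0// mulr_gt0.
have [q qh] := perp_dense v_cyclic v0inv vv0 w0 h0.
set u := trig_op pi q v' in qh.
have h1 : k * rnorm u ^+ 2 <= (d + 2 * h) ^+ 2.
  apply: kP => g Kg; have := wd g Kg; rewrite -/u.
  have := rnormD (pi g w - w) (- (pi g (w - u) - (w - u))).
  have -> : pi g w - w - (pi g (w - u) - (w - u)) = pi g u - u.
    by rewrite piB [- (_ - _ - _)]opprB addrA subrKA opprB addrC subrKA.
  rewrite rnormN; have := rnormD (pi g (w - u)) (- (w - u)); rewrite rnormN rnorm_pi.
  by lra.
have hd : 0 <= d + 2 * h by rewrite addr_ge0// mulr_ge0// ltW.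
have h2 : k * rnorm u <= d + 2 * h.
  rewrite -(@ler_pXn2r _ 2) ?nnegrE ?hd ?mulr_ge0 ?rnorm_ge0 ?(ltW k0)//.
  apply: le_trans h1; rewrite exprMn ler_wpM2r ?sqr_ge0//.
  by rewrite expr2 ler_piMr// ltW.
have := rnormD (w - u) u; rewrite subrK => h3.
rewrite -(ler_pM2l k0) mulrDr mulrA divff ?gt_eqF// mul1r.
have : k * rnorm w <= k * (rnorm (w - u) + rnorm u) by rewrite ler_pM2l.
have : k * rnorm (w - u) <= h by apply: le_trans qh; rewrite ler_piMl ?rnorm_ge0.
rewrite mulrDr; move: h2; rewrite /h [t * k]mulrC.
by have := mulr_gt0 k0 t0; lra.
Qed.

End spectral_gap.

Section gap_coboundary.
Local Open Scope complex_scope.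
Context {R : realType} {G : topologicalZmodType} {H : hilbertType R}.
Variable pi : unitary_rep G H.
Variable v0 : H.
Hypothesis v0inv : forall g, pi g v0 = v0.

Lemma perp_part w : exists2 w', inner w' v0 = 0 &
  forall g, pi g w' - w' = pi g w - w.
Proof.
have [v00|v00] := eqVneq v0 0; first by exists w; rewrite // v00 inner0r.
have n0 : (rnorm v0 ^+ 2)%:C != 0.
  rewrite (inj_eq (@complexI R)) expf_neq0//; apply: contra v00 => /eqP/rnorm_eq0 ->//.
exists (w - (inner w v0 / (rnorm v0 ^+ 2)%:C) *: v0).
  by rewrite innerBl innerZl inner_nr divfK// subrr.
by move=> g; rewrite piB piZ v0inv opprB addrA subrK.
Qed.

Lemma rnorm_small_eq0 (u : H) : (forall e : R, 0 < e -> rnorm u <= e) -> u = 0.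
Proof.
move=> h; apply/rnorm_eq0/eqP; rewrite eq_le rnorm_ge0 andbT.
by apply/ler_addgt0Pr => e e0; rewrite add0r h.
Qed.

(** Vectors whose coboundaries approximate [b] on [K'] form a Cauchy sequence by
    hypothesis.  To see that the coboundary of the limit is [b] at a given [g], compare
    with a vector whose coboundary approximates [b] on [K'] and at [g]. *)
Lemma gap_coboundary (K' : set G) (c : R) (b : Z1 pi) : compact K' -> 0 < c ->
  (forall w d, inner w v0 = 0 -> (forall g, K' g -> rnorm (pi g w - w) <= d) ->
      0 <= d -> rnorm w <= c * d) ->
  closure (@B1 R G H pi) b -> B1 b.
Proof.
move=> cK c0 gapK /closure_B1P clb.
have approx (K : set G) (e : R) : compact K -> 0 < e ->
    exists w, inner w v0 = 0 /\ forall g, K g -> rnorm (b g - (pi g w - w)) <= e.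
  move=> cK1 e0; have [w wP] := clb K e cK1 e0; have [w' w'0 w'E] := perp_part w.
  by exists w'; split=> // g /wP; rewrite w'E; exact: ltW.
have /choice[u uP] : forall n : nat, exists w, inner w v0 = 0 /\
    forall g, K' g -> rnorm (b g - (pi g w - w)) <= n.+1%:R^-1.
  by move=> n; apply: approx => //; rewrite invr_gt0.
have close (w w' : H) (d d' : R) : inner w v0 = 0 -> inner w' v0 = 0 -> 0 <= d -> 0 <= d' ->
    (forall g, K' g -> rnorm (b g - (pi g w - w)) <= d) ->
    (forall g, K' g -> rnorm (b g - (pi g w' - w')) <= d') ->
    rnorm (w - w') <= c * (d + d').
  move=> w0 w'0 d0 d'0 wd w'd; apply: gapK; rewrite ?addr_ge0//.
    by rewrite innerBl w0 w'0 subrr.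
  move=> g Kg; have := wd g Kg; have := w'd g Kg.
  have := rnorm_triangle (b g) (pi g w - w) (pi g w' - w').
  have -> : pi g w - w - (pi g w' - w') = pi g (w - w') - (w - w').
    by rewrite piB !opprB addrACA [RHS]addrACA; congr (_ + _); rewrite addrC.
  by rewrite [rnorm (pi g w - w - b g)]rnormB; lra.
have [ul ulP] : exists l, forall e : R, 0 < e -> exists N, forall n, (N <= n)%N ->
  rnorm (u n - l) <= e.
  apply: rnorm_cauchy_cvg => e e0.
  have [|N NP] := @natSinv_small R (e / (2 * c)); first by rewrite divr_gt0// mulr_gt0.
  exists N => n k Nn Nk.
  have [un0 un] := uP n; have [uk0 uk] := uP k.
  apply: le_trans (close _ _ n.+1%:R^-1 k.+1%:R^-1 un0 uk0 _ _ un uk) _;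
    rewrite ?invr_ge0//.
  have -> : e = c * (e / (2 * c) + e / (2 * c)) by field; rewrite gt_eqF.
  by rewrite ler_pM2l// lerD// NP.
exists ul => g; apply/eqP; rewrite -subr_eq0; apply/eqP/rnorm_small_eq0 => e e0.
pose h := Num.min (e / 8) (e / (16 * c)).
have h0 : 0 < h by rewrite lt_min !divr_gt0// mulr_gt0.
have [he hc] : h <= e / 8 /\ 16 * (c * h) <= e.
  split; first by rewrite ge_min lexx.
  rewrite mulrA mulrC -ler_pdivlMr ?mulr_gt0//.
  by rewrite ge_min lexx orbT.
have [N NP] := natSinv_small h0; have [N' N'P] := ulP h h0.
pose n := maxn N N'.
have nh : n.+1%:R^-1 <= h by apply: NP; exact: leq_maxl.
have unl : rnorm (u n - ul) <= h by apply: N'P; exact: leq_maxr.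
have [un0 un] := uP n.
have [w [w0 wP]] := approx (K' `|` [set g]) h (compactU cK (@compact_set1 _ g)) h0.
have uw : rnorm (u n - w) <= c * (h + h).
  apply: close => //; rewrite ?(ltW h0)// => x Kx; last by apply: wP; left.
  exact: le_trans (un x Kx) nh.
have bw : rnorm (b g - (pi g w - w)) <= h by apply: wP; right.
have d1 (x y : H) : rnorm (pi g x - x - (pi g y - y)) <= 2 * rnorm (x - y).
  have -> : pi g x - x - (pi g y - y) = pi g (x - y) - (x - y).
    by rewrite piB !opprB addrACA [RHS]addrACA; congr (_ + _); rewrite addrC.
  by have := rnormD (pi g (x - y)) (- (x - y)); rewrite rnormN rnorm_pi; lra.
have := d1 w ul; have := rnorm_triangle (pi g w - w) (b g) (pi g ul - ul).
have := rnorm_triangle (u n) w ul; rewrite [rnorm (w - u n)]rnormB.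
by move: uw hc; rewrite mulrDr; lra.
Qed.

End gap_coboundary.

(** * Almost invariant vectors and an unbounded cocycle *)

Section almost_invariant.
Local Open Scope complex_scope.
Context {R : realType} {G : topologicalZmodType} {H : hilbertType R}.
Variable pi : unitary_rep G H.
Local Notation D := (dual R G).
Local Notation one := (trivial_character R G).
Variable mu : probability (borel D) R.
Hypothesis mu_regular : regular_measure mu.
Variable v : H.
Hypothesis v_spec : spectral pi mu v setT.
Variable v0 : H.
Hypothesis v0inv : forall g, pi g v0 = v0.
Local Notation m := (fine (mu [set one])).
Hypothesis v0m : rnorm v0 ^+ 2 = m.
Hypothesis vv0 : inner v v0 = (rnorm v0 ^+ 2)%:C.
Hypothesis lcG : locally_compact [set: G].
Hypothesis punctured_mass : forall U : set D, open U -> U one ->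
  (0 < mu (U `\` [set one]))%E.

Local Notation v' := (v - v0).
Local Notation A1 := (~` [set one] : set (borel D)).

(** Let [a = mean s] have [|a|^2 <= r] on most of the set [E] of characters that are far
    from the trivial one on [K].  On the neighbourhood [U] of the trivial character, where
    characters are close to [1] on [K'], [|a|^2] is at least [rho > r].  For large [n] the
    function [a^n] is thus concentrated outside [E], relative to its norm, which is bounded
    below by the mass of [U] without its centre.  The order of choices matters: [U], [n]
    and the tolerance [t] are determined by [K'] and [r], and the compact part [C] of [E]
    and the multiset [s] are chosen afterwards. *)
Lemma almost_invariant (K : set G) (e : R) : compact K -> 0 < e ->
  exists w, [/\ inner w v0 = 0, w != 0 &
    forall g, K g -> rnorm (pi g w - w) <= e * rnorm w].
Proof.
move=> cK e0; pose e1 := e / 2; have e10 : 0 < e1 by rewrite divr_gt0.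
have [K' cK' [r [r0 r1 KP]]] := @uniform_detection R G K e1 lcG cK e10.
(* [(1 - kp)^2 >= 1 - 2 * kp >= rho]: means of characters that are [kp]-close to [1] on
   [K'] have squared modulus at least [rho]. *)
pose kp := (1 - r) / 8; have kp0 : 0 < kp by rewrite divr_gt0// subr_gt0.
pose rho := (1 + r) / 2.
have rho0 : 0 < rho by rewrite divr_gt0// addr_gt0.
pose U : set D := (~` far_from_one K' kp)^°.
have oU : open U by exact: open_interior.
have U1 : U one by exact: near_one.
have mU : measurable ((U `\` [set one]) : set (borel D)).
  by apply: measurableD; [exact: measurable_open_dual|exact: measurable_one].
pose beta := fine (mu (U `\` [set one])).
have beta0 : 0 < beta.
  rewrite /beta fine_gt0// punctured_mass//= ltey_eq.
  by rewrite fin_num_measure.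
have [n rn] : exists n, (r / rho) ^+ n <= e1 ^+ 2 * beta / 8.
  apply: geometric_small.
  - by rewrite divr_ge0// ltW.
  - by rewrite ltr_pdivrMr// mul1r /rho; lra.
  - by rewrite divr_gt0// mulr_gt0// exprn_gt0.
pose t := e1 ^+ 2 * beta / 8 * rho ^+ n.
have t0 : 0 < t by rewrite !mulr_gt0 ?exprn_gt0// invr_gt0.
have rnt : r ^+ n <= t.
  by move: rn; rewrite expr_div_n ler_pdivrMr// exprn_gt0.
pose E := far_from_one K e1.
have mE : measurable (E : set (borel D)) by apply: measurable_open_dual;
  exact: far_from_one_open.
have [C [cC CE muC]] := inner_regular mu_regular mE t0.
have mC := measurable_compact_dual cC.
have [Y YK YC] := far_finite_detection cC CE.
have [s [s0 sK' sP]] := KP Y YK.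
have n0 : 0 < (size s)%:R :> R by rewrite ltr0n.
pose S := powseq s n.
have evS (xi : D) : normc (mean S xi) ^+ 2 = (normc (mean s xi) ^+ 2) ^+ n.
  by rewrite mean_powseq ?normcX -?exprM 1?mulnC//; exact: char_hom.
have evC xi : C xi -> normc (mean S xi) ^+ 2 <= t.
  move=> Cxi; rewrite evS; apply: le_trans rnt.
  rewrite lerXn2r ?nnegrE ?sqr_ge0 ?(ltW r0)//.
  by apply: sP; [exact: char_hom|exact: YC].
have evU xi : U xi -> rho ^+ n <= normc (mean S xi) ^+ 2.
  move=> /interior_subset Uxi; rewrite evS lerXn2r ?nnegrE ?sqr_ge0 ?(ltW rho0)//.
  have : normc (1 - mean s xi) <= kp.
    have -> : 1 - mean s xi = (\sum_(x <- s) (1 - xi x)) / (size s)%:R.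
      rewrite sumrB big_const_seq count_predT iter_addr_0 mulrBl divff//.
      by rewrite pnatr_eq0 -lt0n.
    rewrite normcM normcV normc_nat ler_pdivrMr//.
    apply: le_trans (normc_sum _ _) _.
    apply: le_trans (_ : \sum_(x <- s) kp <= _); last first.
      by rewrite big_const_seq count_predT iter_addr_0 mulr_natr.
    rewrite big_seq [leRHS]big_seq; apply: ler_sum => x xs.
    rewrite normcB leNgt; apply/negP => h; apply: Uxi; exists x => //; exact: sK'.
  have := le_normcD (1 - mean s xi) (mean s xi); rewrite subrK normc1.
  have := normc_ge0 (mean s xi); set a := normc (mean s xi); set b := normc _.
  move=> a0 h1 h2; have a1 : 1 - kp <= a by lra.
  have kp1 : 0 <= 1 - kp by rewrite /kp; lra.
  apply: le_trans (_ : (1 - kp) ^+ 2 <= _); last by rewrite ler_pXn2r ?nnegrE.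
  by rewrite /rho; move: kp1; rewrite /kp; nra.
pose w := mean_op pi S v'.
have sw : has_symbol pi v' w (fun xi => mean S xi) by exact: symbol_mean.
have vs := v'_spectral v_spec v0inv v0m vv0.
have mA : measurable A1 by exact: measurable_neq_one.
have bS := @bdcont_mean R G S.
have wU : rho ^+ n * beta <= rnorm w ^+ 2.
  have UA : (U `\` [set one]) `<=` (A1 : set D) by move=> xi [].
  rewrite (symbol_norm mA vs sw) (@Rintegral_split _ _ mu _ A1 (U `\` [set one]))//.
  have /le_trans : rho ^+ n * beta <= \int[mu]_(xi in U `\` [set one]) (normc (mean S xi)
    ^+ 2).
    by apply: Rintegral_ge_cst => // xi [/evU].
  apply; rewrite lerDl; apply: Rintegral_ge0 => xi _; exact: sqr_ge0.
have wp : 0 < rnorm w ^+ 2 by apply: lt_le_trans wU; rewrite mulr_gt0// exprn_gt0.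
exists w; split.
- by apply: mean_op_orth => //; exact: v'_orth.
- by apply: contraTneq wp => ->; rewrite rnorm0 expr0n ltxx.
move=> g Kg.
have cs := symbol_coboundary g sw.
have bcs := symbol_bdcont cs.
rewrite -(@ler_pXn2r _ 2) ?nnegrE ?mulr_ge0 ?rnorm_ge0 ?(ltW e0)//.
rewrite (symbol_norm mA vs cs) (@Rintegral_split _ _ mu _ A1 E)//;
  last exact: far_from_one_neq.
have mAE : measurable (A1 `\` E) by exact: measurableD.
have mEC : measurable ((E : set (borel D)) `\` C) by exact: measurableD.
have xi4 (xi : D) : normc (xi g - 1) ^+ 2 <= 4.
  apply: le_trans (normcB_sq_le _ _) _; have [_ ->] := char_hom xi.
  by rewrite normc1 expr1n; lra.
have z1 : \int[mu]_(xi in A1 `\` E) (normc ((xi g - 1) * mean S xi) ^+ 2) <= e1 ^+ 2 *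
  rnorm w ^+ 2.
  apply: le_trans (_ : \int[mu]_(xi in A1 `\` E) (e1 ^+ 2 * normc (mean S xi) ^+ 2) <= _).
    apply: le_Rintegral_bdcont => //; first by apply: bdcontM => //; exact: bdcont_cst.
    move=> xi [_ Exi]; rewrite normcM exprMn ler_wpM2r ?sqr_ge0//.
    rewrite ler_pXn2r ?nnegrE ?normc_ge0 ?(ltW e10)// leNgt; apply/negP => h.
    by apply: Exi; exists g.
  rewrite RintegralZl//; last exact: bdcont_integrable.
  rewrite ler_wpM2l ?sqr_ge0// (symbol_norm mA vs sw) [leRHS](@Rintegral_split _ _ mu _
    A1 (A1 `\` E))//.
  by rewrite lerDl; apply: Rintegral_ge0 => xi _; exact: sqr_ge0.
rewrite (@Rintegral_split _ _ mu _ E C)//.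
have z2 : \int[mu]_(xi in C) (normc ((xi g - 1) * mean S xi) ^+ 2) <= 4 * t.
  apply: le_trans (@Rintegral_le_cst _ _ mu _ _ (4 * t) _ _ _) _ => //.
    move=> xi Cxi; rewrite normcM exprMn.
    by apply: ler_pM; rewrite ?sqr_ge0//; exact: evC.
  have /andP[_ m1] := fine_mu_le1 mu mC.
  by rewrite ler_piMr// mulr_ge0// ltW.
have z3 : \int[mu]_(xi in (E : set (borel D)) `\` C) (normc ((xi g - 1) * mean S xi) ^+
  2) <= 4 * t.
  apply: le_trans (@Rintegral_le_cst _ _ mu _ _ 4 _ _ _) _ => //; last by rewrite ler_pM2l.
  move=> xi _; rewrite normcM exprMn -[leRHS]mulr1.
  by apply: ler_pM; rewrite ?sqr_ge0//; exact: mean_sq_le1.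
have tw : 8 * t <= e1 ^+ 2 * rnorm w ^+ 2.
  have -> : 8 * t = e1 ^+ 2 * (rho ^+ n * beta) by rewrite /t; field.
  by rewrite ler_wpM2l ?sqr_ge0.
have -> : (e * rnorm w) ^+ 2 = 4 * (e1 ^+ 2 * rnorm w ^+ 2) by rewrite /e1; field.
have : 0 <= e1 ^+ 2 * rnorm w ^+ 2 by rewrite mulr_ge0 ?sqr_ge0.
by lra.
Qed.

End almost_invariant.

Section gliding_hump.
Local Open Scope complex_scope.
Context {R : realType} {G : topologicalZmodType} {H : hilbertType R}.
Variable pi : unitary_rep G H.
Hypothesis lcG : locally_compact [set: G].
Hypothesis scG : sigma_compact G.
Hypothesis hump : forall (K : set G) (e : R), compact K -> 0 < e -> exists w g,
  [/\ 0 < rnorm w, forall x, K x -> rnorm (pi x w - w) <= e * rnorm w &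
      rnorm w / 2 <= rnorm (pi g w - w)].

(** The norm [9^n] exceeds by far the sum of the preceding ones, and the precision on [K]
    makes the coboundaries summable there. *)
Lemma scaled_hump (K : set G) n : compact K -> exists wg : H * G,
  [/\ rnorm wg.1 = 9 ^+ n, forall x, K x -> rnorm (pi x wg.1 - wg.1) <= 2 ^- n &
      9 ^+ n / 2 <= rnorm (pi wg.2 wg.1 - wg.1)].
Proof.
move=> cK; have n9 : 0 < 9 ^+ n :> R by rewrite exprn_gt0.
have n2 : 0 < 2 ^- n :> R by rewrite invr_gt0 exprn_gt0.
have e0 : 0 < 2 ^- n / 9 ^+ n :> R by rewrite divr_gt0.
have [w [g [wp wK wg]]] := hump cK e0.
pose a : R := 9 ^+ n / rnorm w; have a0 : 0 < a by rewrite divr_gt0.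
have na : normc a%:C = a.
  by apply: complexI; rewrite -norm_normc ger0_norm// ler0c ltW.
have d x : rnorm (pi x (a%:C *: w) - a%:C *: w) = a * rnorm (pi x w - w).
  by rewrite piZ -scalerBr rnormZ na.
exists (a%:C *: w, g); split => /=.
- by rewrite rnormZ na /a divfK// gt_eqF.
- move=> x Kx; rewrite d; apply: le_trans (_ : a * (2 ^- n / 9 ^+ n * rnorm w) <= _).
    by rewrite ler_pM2l//; exact: wK.
  rewrite le_eqVlt; apply/orP; left; apply/eqP; rewrite /a; field.
  by rewrite !expf_neq0 ?gt_eqF.
- rewrite d; apply: le_trans (_ : a * (rnorm w / 2) <= _).
    by rewrite /a mulrA divfK// gt_eqF.
  by rewrite ler_pM2l.
Qed.

(** Along an exhaustion [L n] of the group by compact sets, sum coboundaries of vectors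
    [u n] of norm [9^n] that are at most [2^-n] on [L n].  The sum converges uniformly on
    each [L n] and is a cocycle.  The point [g n] where the coboundary of [u n] is large is
    put into [L n.+1], so that later terms are small at [g n], and the earlier ones are
    bounded by twice the sum of their norms.  Hence the cocycle is unbounded, whereas
    coboundaries are bounded. *)
Lemma gliding_hump : exists b : Z1 pi, ~ B1 b.
Proof.
have [K [cK KT]] := scG; have [N cN N0] := compact_nbhs0 lcG.
(* Adding the neighbourhood [N] makes [L n.+1] a neighbourhood of each point of [K n],
   which turns uniform convergence on [L n] into locally uniform convergence. *)
pose M n : set G := [set x | exists a b, [/\ K n a, N b & x = a + b]].
have cM n : compact (M n) by exact: compact_sum.
have /choice[h hP] : forall Kn : set G * nat, exists wg : H * G, compact Kn.1 ->
  [/\ rnorm wg.1 = 9 ^+ Kn.2, forall x, Kn.1 x -> rnorm (pi x wg.1 - wg.1) <= 2 ^- Kn.2 &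
      9 ^+ Kn.2 / 2 <= rnorm (pi wg.2 wg.1 - wg.1)].
  move=> [L n]; have [cL|ncL] := pselect (compact L); last by exists (0, 0).
  by have [wg wgP] := scaled_hump n cL; exists wg.
pose L := fix L n := if n is n'.+1 then L n' `|` (M n' `|` [set (h (L n', n')).2]) else
  set0.
have cL n : compact (L n).
  elim: n => [|n IH]; first exact: compact0.
  by apply: compactU => //; apply: compactU => //; exact: compact_set1.
have LS n : L n `<=` L n.+1 by move=> x; left.
have Lmon n k : (n <= k)%N -> L n `<=` L k.
  by elim: k => [|k IH]; [rewrite leqn0 => /eqP ->|
    rewrite leq_eqVlt => /predU1P[->//|/IH hh x /hh /LS]].
pose u n := (h (L n, n)).1; pose g n := (h (L n, n)).2.
have un n : rnorm (u n) = 9 ^+ n by have [] := hP (L n, n) (cL n).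
have uL n x : L n x -> rnorm (pi x (u n) - u n) <= 2 ^- n.
  by have [_ + _] := hP (L n, n) (cL n); exact.
have ug n : 9 ^+ n / 2 <= rnorm (pi (g n) (u n) - u n) by have [] := hP (L n, n) (cL n).
have gL n : L n.+1 (g n) by right; right.
pose U n := \sum_(0 <= k < n) u k.
pose S n x := pi x (U n) - U n.
have US n : U n.+1 = U n + u n by rewrite /U big_nat_recr.
have SS n x : S n.+1 x - S n x = pi x (u n) - u n.
  by rewrite /S US piD [- (U n + u n)]opprD addrACA [X in X - _]addrC addrK.
have Sdiff m n k x : L m x -> (m <= n)%N -> (n <= k)%N ->
    rnorm (S k x - S n x) <= 2 * 2 ^- n - 2 * 2 ^- k.
  move=> Lx mn; elim: k => [|k IH]; first by rewrite leqn0 => /eqP ->;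
    rewrite !subrr rnorm0.
  rewrite leq_eqVlt => /predU1P[->|]; first by rewrite !subrr rnorm0.
  rewrite ltnS => nk; have := IH nk.
  have := rnorm_triangle (S k x) (S k.+1 x) (S n x).
  rewrite SS; have := uL k x (Lmon _ _ (leq_trans mn nk) _ Lx).
  have -> : 2 ^- k = 2 * 2 ^- k.+1 :> R.
    by rewrite exprS invfM mulrA mulfV ?mul1r.
  by lra.
have pow0 k : 0 < 2 ^- k :> R by rewrite invr_gt0 exprn_gt0.
have small2 (e : R) : 0 < e -> exists n0, forall n, (n0 <= n)%N -> 2 ^- n <= e.
  move=> e0; have [n0 n0P] := natSinv_small e0; exists n0 => n nn0.
  apply: le_trans (n0P n nn0); rewrite lef_pV2 ?posrE ?ltr0n ?exprn_gt0//.
  by rewrite -natrX ler_nat ltn_expl.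
have Lx x : exists m, L m x.
  have [n _ Knx] : (\bigcup_n K n) x by rewrite KT.
  exists n.+1; right; left; exists x, 0; rewrite addr0; split=> //.
  exact: nbhs_singleton.
have /choice[b bP] : forall x, exists l, forall m n, L m x -> (m <= n)%N ->
    rnorm (S n x - l) <= 2 * 2 ^- n.
  move=> x; have [m0 Lm0] := Lx x.
  have [|l lP] := @rnorm_cauchy_cvg _ _ (fun n => S n x).
    move=> e e0; have e2 : 0 < e / 4 by rewrite divr_gt0.
    have [n0 n0P] := small2 _ e2; exists (maxn m0 n0) => n k.
    rewrite !geq_max => /andP[mn nn] /andP[mk nk].
    have h1 := n0P n nn; have h2 := n0P k nk.
    have [nk'|/ltnW kn'] := leqP n k.
      rewrite rnormB; have := Sdiff _ _ _ _ Lm0 mn nk'; have := pow0 k; have := pow0 n; lra.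
    by have := Sdiff _ _ _ _ Lm0 mk kn'; have := pow0 k; have := pow0 n; lra.
  exists l => m n Lm mn; apply/ler_addgt0Pr => e e0.
  have [n0 n0P] := lP e e0; pose k := maxn n n0.
  have := n0P k (leq_maxr _ _); have := Sdiff _ _ _ _ Lm mn (leq_maxl n n0).
  have := rnorm_triangle (S k x) (S n x) l; rewrite [rnorm (S n x - S k x)]rnormB -/k.
  by have := pow0 k; lra.
have bcont : continuous b.
  apply/continuous_rnormP => x e e0; have [n _ Knx] : (\bigcup_n K n) x by rewrite KT.
  have e8 : 0 < e / 8 by rewrite divr_gt0.
  have [n0 n0P] := small2 _ e8; pose k := maxn n.+1 n0.
  have := (continuous_rnormP _).1 (@cocycle_cont R G H pi (coboundary pi (U k))) x (e / 4).
  rewrite divr_gt0// => /(_ isT) Sx.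
  have Nx := nbhs_translate x N0.
  apply: filterS2 Sx Nx => y /= Sxy Ny.
  have Ly : L k y.
    apply: (Lmon n.+1); first exact: leq_maxl.
    by right; left; exists x, (y - x); split=> //; rewrite [RHS]addrC subrK.
  have Lkx : L k x.
    apply: (Lmon n.+1); first exact: leq_maxl.
    by right; left; exists x, 0; rewrite addr0; split=> //; exact: nbhs_singleton.
  have h1 := bP y _ _ Ly (leqnn k); have h2 := bP x _ _ Lkx (leqnn k).
  have h3 := n0P k (leq_maxr _ _).
  have := rnorm_triangle (S k x) (b x) (b y).
  have := rnorm_triangle (S k y) (S k x) (b y).
  by move: Sxy h2; rewrite -/(S k x) -/(S k y) [rnorm (b x - S k x)]rnormB; lra.
have bcoc : forall x y, b (x + y) = pi x (b y) + b x.
  move=> x y; apply/eqP; rewrite -subr_eq0; apply/eqP/rnorm_small_eq0 => e e0.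
  have e8 : 0 < e / 8 by rewrite divr_gt0.
  have [n0 n0P] := small2 _ e8.
  have [mx Lmx] := Lx x; have [my Lmy] := Lx y; have [mz Lmz] := Lx (x + y).
  pose k := maxn (maxn mx my) (maxn mz n0).
  have kmx : (mx <= k)%N by rewrite !leq_max leqnn.
  have kmy : (my <= k)%N by rewrite !leq_max leqnn orbT.
  have kmz : (mz <= k)%N by rewrite !leq_max leqnn !orbT.
  have kn0 : (n0 <= k)%N by rewrite !leq_max leqnn !orbT.
  have := n0P k kn0.
  have := bP _ _ _ Lmx kmx; have := bP _ _ _ Lmy kmy; have := bP _ _ _ Lmz kmz.
  have Sc : S k (x + y) - (pi x (b y) + b x) = pi x (S k y - b y) + (S k x - b x).
    have -> : S k (x + y) = pi x (S k y) + S k x by rewrite /S repD piB addrA subrK.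
    by rewrite opprD addrACA -piB.
  have := rnorm_triangle (S k (x + y)) (b (x + y)) (pi x (b y) + b x).
  rewrite Sc.
  have := rnormD (pi x (S k y - b y)) (S k x - b x); rewrite rnorm_pi.
  by rewrite [rnorm (b (x + y) - S k _)]rnormB; lra.
have bZ : b \in is_cocycle pi by exact/asboolP.
exists (Cocycle bZ) => -[w wP].
have bw x : rnorm (b x) <= 2 * rnorm w.
  have := wP x; rewrite /= => ->.
  by have := rnormD (pi x w) (- w); rewrite rnormN rnorm_pi; lra.
(* [1 + 9 + ... + 9^(n-1) <= 9^n / 8] *)
have Un n : rnorm (U n) <= 9 ^+ n / 8.
  elim: n => [|n IH]; first by rewrite /U big_nil rnorm0 divr_ge0.
  rewrite US exprS; have := rnormD (U n) (u n); rewrite un; lra.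
have grow n : 9 ^+ n / 4 - 1 <= 2 * rnorm w.
  apply: le_trans (bw (g n)).
  have := bP _ _ _ (gL n) (leqnn _).
  have := ug n; rewrite -SS.
  have : rnorm (S n (g n)) <= 9 ^+ n / 4.
    by have := rnormD (pi (g n) (U n)) (- U n); rewrite rnormN rnorm_pi; have := Un n;
      rewrite /S; lra.
  have := rnormD (S n.+1 (g n)) (- S n (g n)); rewrite rnormN.
  have := rnormD (S n.+1 (g n) - b (g n)) (b (g n)); rewrite subrK.
  have : 2 * 2 ^- n.+1 <= 1 :> R.
    rewrite exprS invfM mulrA mulfV// mul1r invf_le1 ?exprn_gt0//.
    by rewrite exprn_ege1// ler1n.
  by lra.
have w0 := rnorm_ge0 w.
have [] := @natSinv_small R (8 * rnorm w + 5)^-1.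
  by rewrite invr_gt0; lra.
move=> n /(_ n (leqnn n)); rewrite lef_pV2 ?posrE ?ltr0n//; last by lra.
have : n.+1%:R <= 9 ^+ n :> R by rewrite -natrX ler_nat ltn_expl.
by have := grow n; move: (9 ^+ n) (n.+1%:R) => a c; lra.
Qed.

End gliding_hump.

(** * The theorem *)

Section decomposition.
Context {R : realType} {G : topologicalZmodType}.
Local Notation D := (dual R G).
Local Notation one := (trivial_character R G).
Variables mu muperp : probability (borel D) R.
Hypothesis mu_decomposition : forall A : set (borel D), measurable A ->
    mu A = (mu [set one] * dirac (one : borel D) A
            + (1 - mu [set one]) * muperp A)%E.
Local Notation m := (fine (mu [set one])).

Lemma mu_decomposition_fine (A : set (borel D)) : measurable A ->
  fine (mu A) = m * (\1_A (one : borel D)) + (1 - m) * fine (muperp A).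
Proof.
move=> mA; rewrite (mu_decomposition mA) diracE.
have f1 : mu [set one] \is a fin_num by apply: fin_num_measure; exact: measurable_one.
have f2 : muperp A \is a fin_num by exact: fin_num_measure.
rewrite -{1 2}(fineK f1) -{1}(fineK f2) -EFinM -EFinB -EFinM -EFinD /= indicE.
by [].
Qed.

Lemma no_mass_near_one (U : set D) : open U -> muperp U = 0%E ->
  mu (U `\` [set one]) = 0%E.
Proof.
move=> oU U0.
have mU : measurable (U : set (borel D)) by exact: measurable_open_dual.
have mU1 : measurable ((U `\` [set one]) : set (borel D)).
  by apply: measurableD => //; exact: measurable_one.
have U10 : muperp (U `\` [set one]) = 0%E.
  apply/eqP; rewrite eq_le measure_ge0 andbT -U0; apply: le_measure; rewrite ?inE//.
have := mu_decomposition_fine mU1; rewrite U10 mulr0 addr0 indicE.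
rewrite memNset ?mulr0; last by move=> [_]; exact.
by move=> h; rewrite -[LHS]fineK ?h//; exact: fin_num_measure.
Qed.

(** The decomposition forces [muperp] to have no atom at the trivial character when
    [m < 1], so mass of [muperp] near that character lies off it, where [mu] is a
    positive multiple of [muperp]. *)
Lemma supp_punctured_mass (U : set D) : m < 1 -> open U -> U one ->
  supp muperp one -> (0 < mu (U `\` [set one]))%E.
Proof.
move=> m1 oU U1 /(_ U oU U1) Up; rewrite lt0e measure_ge0 andbT; apply/eqP => U0.
have m1' : 0 < 1 - m by rewrite subr_gt0.
have mU : measurable (U : set (borel D)) by exact: measurable_open_dual.
have mo : measurable ([set one] : set (borel D)) by exact: measurable_one.
have mU1 : measurable ((U `\` [set one]) : set (borel D)) by exact: measurableD.
have z1 : fine (muperp (U `\` [set one])) = 0.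
  have := mu_decomposition_fine mU1; rewrite U0 indicE.
  rewrite memNset ?mulr0 ?add0r; last by move=> [_]; exact.
  by move=> /esym/eqP; rewrite mulf_eq0 gt_eqF//= => /eqP.
have z2 : fine (muperp [set one]) = 0.
  have := mu_decomposition_fine mo; rewrite indicE mem_set// mulr1.
  move=> h; have /eqP : (1 - m) * fine (muperp [set one]) = 0 by lra.
  by rewrite mulf_eq0 gt_eqF//= => /eqP.
have : muperp U = 0%E.
  have -> : U = (U `\` [set one]) `|` [set one] by rewrite setUC setDUK// => _ ->.
  have z1' : muperp (U `\` [set one]) = 0%E.
    by rewrite -[LHS]fineK ?z1//; exact: fin_num_measure.
  have z2' : muperp [set one] = 0%E.
    by rewrite -[LHS]fineK ?z2//; exact: fin_num_measure.
  transitivity (muperp (U `\` [set one]) + muperp [set one])%E.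
    by apply: measureU => //; rewrite setDE -setIA setICl setI0.
  by rewrite z1' z2' adde0.
move=> h; have Ule : (muperp U <= 0)%E by rewrite h.
by have := lt_le_trans Up Ule; rewrite ltxx.
Qed.

End decomposition.

Theorem theorem1 (R : realType) (G : topologicalZmodType)
  (G_hausdorff : hausdorff_space G) (G_lc : locally_compact [set: G])
  (phi : G -> R[i]^o)
  (phi_continuous : continuous phi)
  (phi_pd : positive_definite phi)
  (phi_normalized : phi 0 = 1)
  (phi_nonconstant : ~ exists c, forall x, phi x = c)
  (H : hilbertType R) (pi : unitary_rep G H) (v : H)
  (gns : is_GNS phi pi v)
  (mu : probability (borel (dual R G)) R)
  (mu_regular : regular_measure mu)
  (bochner : forall x, phi x = complex_integral mu (fun xi => xi x))
  (muperp : probability (borel (dual R G)) R)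
  (mu_decomposition : forall A : set (borel (dual R G)), measurable A ->
    mu A = (mu [set trivial_character R G]
              * dirac (trivial_character R G : borel (dual R G)) A
            + (1 - mu [set trivial_character R G]) * muperp A)%E) :
  let H1_zero := forall b : H1 pi, b = 0 in
  let reduced_H1_zero := forall b : reduced_H1 pi, b = 0 in
  let cond_a := mu [set trivial_character R G] = 0%E \/
                additive_characters R G = [set (fun=> 0)] in
  let cond_b := ~ supp muperp (trivial_character R G) in
  (((cond_a /\ cond_b) -> H1_zero) /\
   (sigma_compact G -> H1_zero -> (cond_a /\ cond_b))) /\
  (reduced_H1_zero <-> cond_a).
Proof.
move=> H1_zero reduced_H1_zero cond_a cond_b.
have [vcyc vphi] := gns.
have v_spec : spectral pi mu v setT by move=> x; rewrite vphi bochner.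
have [v0 [v0inv v0m vv0]] := invariant_projection mu_regular v_spec.
set one := trivial_character R G in v0m cond_a cond_b mu_decomposition *.
have mo : measurable ([set one] : set (borel (dual R G))) by exact: measurable_one.
have fo : mu [set one] \is a fin_num by exact: fin_num_measure.
have mu1_v0 : mu [set one] = 0%E <-> v0 = 0.
  split=> [h|h].
    by apply: rnorm_eq0; apply/eqP; rewrite -sqrf_eq0 v0m h.
  by rewrite -[LHS]fineK// -v0m h rnorm0 expr0n.
(* If the atom had full mass, [v] would equal [v0] and [phi] would be constant. *)
have m1 : fine (mu [set one]) < 1.
  have /andP[_] := fine_mu_le1 mu mo; rewrite le_eqVlt => /predU1P[m1|//].
  have nv0 : rnorm v0 ^+ 2 = 1 by rewrite v0m.
  have vE : v = v0.
    have : rnorm v ^+ 2 = rnorm (v - v0) ^+ 2 + rnorm v0 ^+ 2.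
      by rewrite -pythagoras ?subrK//; exact: v'_orth.
    rewrite (rnorm_cyclic_vector v_spec) expr1n nv0 => h.
    have /eqP : rnorm (v - v0) ^+ 2 = 0 by lra.
    by rewrite sqrf_eq0 => /eqP/rnorm_eq0/eqP; rewrite subr_eq0 => /eqP.
  case: phi_nonconstant; exists (inner v v) => x.
  by rewrite -vphi vE v0inv.
(* The component of a cocycle along the invariant vector is a continuous
   homomorphism. *)
have cocycle_perp (b : Z1 pi) : cond_a -> forall g, inner (b g) v0 = 0.
  move=> [/mu1_v0 ->|no_hom] g; first by rewrite inner0r.
  have : additive_characters R G (fun g => inner (b g) v0).
    split.
      move=> x; apply: (@cvgrPdist_lt _ _ _ _ (nbhs_filter x) _ _).2 => -[e e'].
      move=> /[dup] e0; rewrite ltcE/= => /andP[/eqP e'0 er0].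
      have d0 : 0 < e / (rnorm v0 + 1) by rewrite divr_gt0// ltr_wpDl ?rnorm_ge0.
      have := (continuous_rnormP _).1 (@cocycle_cont R G H pi b) x _ d0.
      apply: filterS => y /= xy; rewrite -innerBl norm_normc e'0 ltcR.
      apply: le_lt_trans (cauchy_schwarz _ _) _.
      apply: le_lt_trans (_ : rnorm (b x - b y) * (rnorm v0 + 1) < _).
        by rewrite ler_wpM2l ?rnorm_ge0// lerDl.
      by rewrite -ltr_pdivlMr// ltr_wpDl ?rnorm_ge0.
    by move=> x y; rewrite cocycleD innerDl inner_pi_v0// addrC.
  by rewrite no_hom => /(congr1 (fun f => f g)).
have reduced_iff : reduced_H1_zero <-> cond_a.
  split=> [/reduced_H1_eq0 h|ca].
    have [m0|m0] := eqVneq (mu [set one]) 0%E; [by left|right].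
    have nv0 : rnorm v0 != 0.
      by apply: contra m0 => /eqP/rnorm_eq0/mu1_v0 ->.
    apply/seteqP; split; last first.
      by move=> f ->; split=> [|x y]; [exact: cst_continuous|rewrite addr0].
    move=> f [fc fD] /=.
    have fZ : (fun g => f g *: v0) \in is_cocycle pi.
      apply/asboolP; split; last by move=> x y; rewrite piZ v0inv fD scalerDl addrC.
      move=> x; apply: cvgZr_tmp; exact: fc.
    apply/funext => g.
    have fg (e : R) : 0 < e -> normc (f g) * rnorm v0 <= e.
      move=> e0; have /closure_B1P := h (Cocycle fZ).
      move=> /(_ [set g] e (@compact_set1 _ g) e0)[w /(_ g erefl)] /= hw.
      have o : inner (pi g w - w) (f g *: v0) = 0.
        by rewrite innerZr innerBl inner_pi_v0// subrr mulr0.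
      have o' : inner (f g *: v0) (- (pi g w - w)) = 0.
        by rewrite innerNr innerC o conjc0 oppr0.
      rewrite -rnormZ; apply: le_trans (ltW hw).
      rewrite -(@ler_pXn2r _ 2) ?nnegrE ?rnorm_ge0// (pythagoras o').
      by rewrite lerDl sqr_ge0.
    have : rnorm (f g *: v0) = 0 by rewrite (@rnorm_small_eq0 R H (f g *: v0)) ?rnorm0//
      => e e0; rewrite rnormZ fg.
    by rewrite rnormZ => /eqP; rewrite mulf_eq0 (negPf nv0) orbF => /eqP/eq0_normc.
  by apply/reduced_H1_eq0 => b;
    apply: (perp_cocycle_closure mu_regular v_spec vcyc v0inv v0m vv0 (cocycle_perp b ca)).
split=> //; split=> [[ca cb]|sc h1].
- apply/H1_eq0 => b.
  have [U [oU U1 muU]] : exists U : set (dual R G), [/\ open U, U one & muperp U = 0%E].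
    apply: contrapT => nU; apply: cb => U oU U1.
    rewrite lt0e measure_ge0 andbT; apply/eqP => h; apply: nU; by exists U.
  have [K [e [cK e0 KU]]] := open_one_far_from_one oU U1.
  have mu0 : mu (~` [set one] `\` far_from_one K e) = 0%E.
    apply/eqP; rewrite eq_le measure_ge0 andbT.
    rewrite -(no_mass_near_one mu_decomposition oU muU); apply: le_measure; rewrite ?inE.
    + apply: measurableD; first exact: measurableC.
      by apply: measurable_open_dual; exact: far_from_one_open.
    + by apply: measurableD => //; exact: measurable_open_dual.
    + by move=> xi [xi1 /KU Uxi].
  have [K' cK' [c c0 gapK]] := spectral_gap mu_regular v_spec vcyc v0inv v0m vv0 G_lc cK
    e0 mu0.
  apply: (gap_coboundary v0inv cK' c0 gapK).
  exact: (perp_cocycle_closure mu_regular v_spec vcyc v0inv v0m vv0 (cocycle_perp b ca)).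
- have hB := (H1_eq0 pi).1 h1.
  split; first by apply/reduced_iff/reduced_H1_eq0 => b; apply: subset_closure; exact: hB.
  move=> sp1.
  have [|b nb] := @gliding_hump R G H pi G_lc sc; last exact/nb/hB.
  move=> K e cK e0.
  have acc (U : set (dual R G)) : open U -> U one -> (0 < mu (U `\` [set one]))%E.
    by move=> oU U1; apply: (supp_punctured_mass mu_decomposition).
  have [w [w0 wn0 wK]] := almost_invariant mu_regular v_spec v0inv v0m vv0 G_lc acc cK e0.
  have [g gw] := coboundary_large mu_regular v_spec vcyc v0inv v0m vv0 w0 wn0.
  exists w, g; split=> //.
  by rewrite lt_def rnorm_ge0 andbT; apply: contra wn0 => /eqP/rnorm_eq0 ->.
Qed.
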